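(* Let $K$ be a field and let $\mathcal{P}_{\mathcal{A}}$ be the transversal polymatroid presented by a family $\mathcal{A}=(A_1,\ldots,A_s)$ of nonempty subsets of $[n]$ with $A_1\cup\cdots\cup A_s=[n]$. Let $d>0$ be an integer. Then $\mathrm{Cl}(R_{\mathcal{P}_{\mathcal{A}}})\cong\mathbb{Z}/d\mathbb{Z}$ if and only if $A_1=\cdots=A_s=[n]$ and $s=d$.
   Context: Let $[n]=\{1,\ldots,n\}$ and let $\mathbf{e}_1,\ldots,\mathbf{e}_n$ be the standard basis of $\mathbb{Z}^n$; $\mathbf{u}\le\mathbf{v}$ means $u_i\le v_i$ for all $i$. Repetitions among the $A_i$ are allowed. The transversal polymatroid presented by $\mathcal{A}=(A_1,\ldots,A_s)$ is the set $\mathcal{P}_{\mathcal{A}}$ of all $\mathbf{u}\in\mathbb{Z}_{\ge0}^n$ such that $\mathbf{u}\le\mathbf{e}_{i_1}+\cdots+\mathbf{e}_{i_s}$ for some $i_1\in A_1,\ldots,i_s\in A_s$ (the discrete polymatroid whose set of bases is $\{\mathbf{e}_{i_1}+\cdots+\mathbf{e}_{i_s} : i_k\in A_k\}$). Its toric ring is $R_{\mathcal{P}_{\mathcal{A}}}=K[\mathbf{x}^{\mathbf{v}}t : \mathbf{v}\in\mathcal{P}_{\mathcal{A}}]\subset K[x_1,\ldots,x_n,t]$, where $\mathbf{x}^{\mathbf{v}}=\prod_i x_i^{v_i}$; it is a normal domain, and $\mathrm{Cl}$ denotes its divisor class group. *)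

(* Defs.v *)
From HB Require Import structures.
From mathcomp Require Import all_boot all_algebra fraction generic_quotient.
From mathcomp Require Import boolp classical_sets.
From mathcomp Require Import mpoly.

Set Implicit Arguments.
Unset Strict Implicit.
Unset Printing Implicit Defensive.

Import GRing.Theory.
Local Open Scope classical_set_scope.
Local Open Scope quotient_scope.
Local Open Scope ring_scope.

(* The divisor class group of a domain R is the quotient of the divisorial    *)
(* fractional ideals, under the product (I, J) |-> (R : (R : IJ)), by the     *)
(* principal ones. For an arbitrary domain this quotient is a commutative     *)
(* monoid, and it is built here at that level of generality; it is a group    *)
(* exactly when R is completely integrally closed, in particular when R is a  *)
(* Noetherian normal domain, where it is the usual Cl(R).                     *)

Section DivisorialIdeals.
Variable R : idomainType.
Local Notation F := {fraction R}.
Implicit Types (I J L : set F) (x y z c : F).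

Definition base_ring : set F := range (@tofrac R).

(* Closure under 0 and opposites follows from the clauses below. *)
Definition fractional_ideal I : Prop :=
  [/\ exists2 x, I x & x != 0,
      forall x y, I x -> I y -> I (x + y),
      forall (r : R) x, I x -> I (tofrac r * x) &
      exists2 d : R, d != 0 & forall x, I x -> base_ring (tofrac d * x)].

(* The colon R : I inside the fraction field. *)
Definition ideal_inv I : set F := [set x | forall y, I y -> base_ring (x * y)].

Definition ideal_mul I J : set F :=
  [set z | exists2 s : seq (F * F),
     forall p, p \in s -> I p.1 /\ J p.2 & z = \sum_(p <- s) p.1 * p.2].

Definition ideal_scale c I : set F := [set c * x | x in I].

Definition divisorial_ideal I : Prop :=
  fractional_ideal I /\ ideal_inv (ideal_inv I) = I.

Definition div_mul I J : set F := ideal_inv (ideal_inv (ideal_mul I J)).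

Lemma base_ringD x y : base_ring x -> base_ring y -> base_ring (x + y).
Proof. by move=> [a _ <-] [b _ <-]; exists (a + b); rewrite ?rmorphD. Qed.

Lemma base_ringM x y : base_ring x -> base_ring y -> base_ring (x * y).
Proof. by move=> [a _ <-] [b _ <-]; exists (a * b); rewrite ?rmorphM. Qed.

Lemma base_ring_tofrac (r : R) : base_ring (tofrac r).
Proof. by exists r. Qed.
Local Hint Resolve base_ring_tofrac : core.

Lemma base_ring1 : base_ring 1.
Proof. by exists 1; rewrite ?rmorph1. Qed.

Lemma base_ring_sum (T : eqType) (s : seq T) (f : T -> F) :
  (forall t, t \in s -> base_ring (f t)) -> base_ring (\sum_(t <- s) f t).
Proof.
move=> h; rewrite big_seq; elim/big_ind: _ => //; last exact: base_ringD.
by exists 0; rewrite ?rmorph0.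
Qed.

Lemma ideal_inv_sub I J : I `<=` J -> ideal_inv J `<=` ideal_inv I.
Proof. by move=> sIJ x h y Iy; apply/h/sIJ. Qed.

Lemma sub_ideal_invK I : I `<=` ideal_inv (ideal_inv I).
Proof. by move=> x Ix y hy; rewrite mulrC; apply: hy. Qed.

Lemma ideal_inv3 I : ideal_inv (ideal_inv (ideal_inv I)) = ideal_inv I.
Proof.
by apply/seteqP; split; [apply/ideal_inv_sub/sub_ideal_invK
                        |apply: sub_ideal_invK].
Qed.

Lemma ideal_inv_mulP I J x :
  ideal_inv (ideal_mul I J) x <->
  forall y z, I y -> J z -> base_ring (x * (y * z)).
Proof.
split=> [h y z Iy Jz|h _ [s hs ->]].
  apply: h; exists [:: (y, z)]; last by rewrite big_seq1.
  by move=> p; rewrite inE => /eqP->.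
rewrite mulr_sumr; apply: base_ring_sum => p /hs[Ip Jp]; exact: h.
Qed.

Lemma ideal_inv_inj I J : ideal_inv I = ideal_inv J ->
  ideal_inv (ideal_inv I) = ideal_inv (ideal_inv J).
Proof. by move->. Qed.

Lemma ideal_mulC I J : ideal_mul I J = ideal_mul J I.
Proof.
suff H I' J' : ideal_mul I' J' `<=` ideal_mul J' I' by apply/seteqP.
move=> _ [s hs ->]; exists [seq (p.2, p.1) | p <- s].
  by move=> _ /mapP[p /hs[Ip Jp] ->].
by rewrite big_map; apply: eq_bigr => p _; rewrite mulrC.
Qed.

Lemma div_mulC I J : div_mul I J = div_mul J I.
Proof. by rewrite /div_mul ideal_mulC. Qed.

Lemma inv_div_mulP I J L x :
  ideal_inv (ideal_mul (div_mul I J) L) x <->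
  forall a b c, I a -> J b -> L c -> base_ring (x * (a * b * c)).
Proof.
split=> [/ideal_inv_mulP h a b c Ia Jb Lc|h].
  apply: h => //; apply: sub_ideal_invK; exists [:: (a, b)].
    by move=> p; rewrite inE => /eqP->.
  by rewrite big_seq1.
apply/ideal_inv_mulP => u c Du Lc.
rewrite (_ : _ * _ = u * (x * c)); last by rewrite mulrCA.
apply: Du; apply/ideal_inv_mulP => a b Ia Jb.
by rewrite -mulrA [c * _]mulrC; apply: h.
Qed.

Lemma div_mulA I J L : div_mul I (div_mul J L) = div_mul (div_mul I J) L.
Proof.
rewrite [LHS]div_mulC; apply: ideal_inv_inj; apply/seteqP.
split=> x /inv_div_mulP h; apply/inv_div_mulP => a b c ? ? ?.
  by have := h b c a; rewrite [b * c * a]mulrC [a * (b * c)]mulrA; apply.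
by have := h c a b; rewrite -[c * a * b]mulrA [c * (a * b)]mulrC; apply.
Qed.

Lemma div_mul1 I : ideal_inv (ideal_inv I) = I -> div_mul base_ring I = I.
Proof.
move=> Idiv; rewrite -[RHS]Idiv; apply: ideal_inv_inj; apply/seteqP.
split=> x => [/ideal_inv_mulP h y Iy|h].
  by rewrite -[y]mul1r; apply: h => //; apply: base_ring1.
by apply/ideal_inv_mulP => r y Rr Iy; rewrite mulrCA; apply: base_ringM => //; apply: h.
Qed.

Lemma fractional_ideal_inv I : fractional_ideal I -> fractional_ideal (ideal_inv I).
Proof.
move=> [[x Ix x0] _ IM [d d0 hd]]; split.
- by exists (tofrac d); rewrite ?tofrac_eq0.
- by move=> y z hy hz w Iw; rewrite mulrDl; apply: base_ringD; [apply: hy|apply: hz].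
- by move=> r y hy w Iw; rewrite -mulrA; apply: base_ringM => //; apply: hy.
- have [a _ ea] := hd _ Ix; exists a.
    by rewrite -tofrac_eq0 ea mulf_neq0 ?tofrac_eq0.
  by move=> y hy; rewrite mulrC; apply: hy; rewrite ea; apply: IM.
Qed.

Lemma fractional_ideal_mul I J :
  fractional_ideal I -> fractional_ideal J -> fractional_ideal (ideal_mul I J).
Proof.
move=> [[x Ix x0] _ IM [d d0 hd]] [[y Jy y0] _ _ [e e0 he]]; split.
- exists (x * y); last by rewrite mulf_neq0.
  exists [:: (x, y)]; last by rewrite big_seq1.
  by move=> p; rewrite inE => /eqP->.
- move=> _ _ [s hs ->] [t ht ->]; exists (s ++ t); last by rewrite big_cat.
  by move=> p; rewrite mem_cat => /orP[/hs|/ht].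
- move=> r _ [s hs ->]; exists [seq (tofrac r * p.1, p.2) | p <- s].
    by move=> _ /mapP[p /hs[Ip Jp] ->]; split=> //; apply: IM.
  by rewrite big_map mulr_sumr; apply: eq_bigr => p _; rewrite mulrA.
- exists (d * e); first by rewrite mulf_neq0.
  move=> _ [s hs ->]; rewrite mulr_sumr; apply: base_ring_sum => p /hs[Ip Jp].
  by rewrite rmorphM mulrACA; apply: base_ringM; [apply: hd|apply: he].
Qed.

Lemma divisorial_div_mul I J :
  divisorial_ideal I -> divisorial_ideal J -> divisorial_ideal (div_mul I J).
Proof.
move=> [fI _] [fJ _]; split; last exact: ideal_inv3.
by do 2!apply: fractional_ideal_inv; apply: fractional_ideal_mul.
Qed.

Lemma divisorial_base_ring : divisorial_ideal base_ring.
Proof.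
have R1 := base_ring1.
have e : ideal_inv base_ring = base_ring.
  apply/seteqP; split=> x; last by move=> Rx y; apply: base_ringM.
  by move=> /(_ _ R1); rewrite mulr1.
split; last by rewrite !e.
split=> //; first by exists 1; rewrite ?oner_neq0.
- exact: base_ringD.
- by move=> r x; apply: base_ringM.
- by exists 1; rewrite ?oner_neq0 // => x; rewrite rmorph1 mul1r.
Qed.

Lemma ideal_scale1 I : ideal_scale 1 I = I.
Proof.
apply/seteqP; split=> x; first by case=> y Iy <-; rewrite mul1r.
by move=> Ix; exists x; rewrite ?mul1r.
Qed.

Lemma ideal_scaleM c d I : ideal_scale c (ideal_scale d I) = ideal_scale (c * d) I.
Proof.
apply/seteqP; split=> x; first by case=> _ [y Iy <-] <-; exists y; rewrite ?mulrA.
by case=> y Iy <-; exists (d * y); [exists y | rewrite mulrA].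
Qed.

Lemma ideal_inv_scale c I :
  c != 0 -> ideal_inv (ideal_scale c I) = ideal_scale c^-1 (ideal_inv I).
Proof.
move=> c0; apply/seteqP; split=> x => [h|[y hy <-] _ [z Iz <-]].
  exists (c * x); last by rewrite mulKf.
  by move=> y Iy; rewrite [c * x]mulrC -mulrA; apply: h; exists y.
by rewrite mulrACA mulVf // mul1r; apply: hy.
Qed.

Lemma ideal_mul_scale c I J : ideal_mul (ideal_scale c I) J = ideal_scale c (ideal_mul I J).
Proof.
apply/seteqP; split=> x.
  case=> s + ->; elim: s => [|[a b] s IHs] h.
    by rewrite big_nil; exists 0; rewrite ?mulr0 //; exists [::]; rewrite ?big_nil.
  have [_ [t ht ->] e] : ideal_scale c (ideal_mul I J) (\sum_(p <- s) p.1 * p.2).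
    by apply: IHs => p ps; apply: h; rewrite inE ps orbT.
  have [/= [a' Ia' ea] Jb] := h (a, b) (mem_head _ _).
  exists (\sum_(p <- (a', b) :: t) p.1 * p.2).
    exists ((a', b) :: t) => // p; rewrite inE => /orP[/eqP-> //|]; exact: ht.
  by rewrite !big_cons /= mulrDr e -ea mulrA.
case=> _ [s hs ->] <-; exists [seq (c * p.1, p.2) | p <- s].
  by move=> _ /mapP[p /hs[Ip Jp] ->]; split=> //; exists p.1.
by rewrite big_map mulr_sumr; apply: eq_bigr => p _; rewrite mulrA.
Qed.

Lemma div_mul_scale c I J :
  c != 0 -> div_mul (ideal_scale c I) J = ideal_scale c (div_mul I J).
Proof.
by move=> c0; rewrite /div_mul ideal_mul_scale !ideal_inv_scale ?invr_eq0 ?invrK.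
Qed.

End DivisorialIdeals.

Record divisorial (R : idomainType) := Divisorial {
  divisorial_set :> set {fraction R};
  divisorial_setP : `[< divisorial_ideal divisorial_set >] }.

HB.instance Definition _ (R : idomainType) := [isSub for @divisorial_set R].
HB.instance Definition _ (R : idomainType) := [Choice of divisorial R by <:].

Section ClassGroup.
Variable R : idomainType.
Implicit Types I J : divisorial R.

Lemma divisorialP I : divisorial_ideal I.
Proof. exact/asboolP/divisorial_setP. Qed.

Definition divisorial_one : divisorial R := Divisorial (asboolT (divisorial_base_ring R)).

Definition divisorial_mul I J : divisorial R :=
  Divisorial (asboolT (divisorial_div_mul (divisorialP I) (divisorialP J))).

(* As I = cJ = (cR)J, this is congruence modulo principal fractional ideals. *)
Definition class_equiv : rel (divisorial R) := fun I J =>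
  `[< exists2 c : {fraction R}, c != 0 & divisorial_set I = ideal_scale c J >].

Lemma class_equiv_refl : reflexive class_equiv.
Proof. by move=> I; apply/asboolP; exists 1; rewrite ?oner_neq0 ?ideal_scale1. Qed.

Lemma class_equiv_sym : ssrbool.symmetric class_equiv.
Proof.
suff H I J : class_equiv I J -> class_equiv J I by move=> I J; apply/idP/idP; apply: H.
move=> /asboolP[c c0 e]; apply/asboolP; exists c^-1; rewrite ?invr_eq0 //.
by rewrite e ideal_scaleM mulVf // ideal_scale1.
Qed.

Lemma class_equiv_trans : transitive class_equiv.
Proof.
move=> J I L /asboolP[c c0 e] /asboolP[d d0 f]; apply/asboolP.
by exists (c * d); rewrite ?mulf_neq0 // e f ideal_scaleM.
Qed.

Canonical class_equivalence :=
  EquivRel class_equiv class_equiv_refl class_equiv_sym class_equiv_trans.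

Definition Cl := {eq_quot class_equivalence}.

HB.instance Definition _ := Choice.on Cl.
HB.instance Definition _ := EqQuotient.on Cl.

Definition Cl_zero : Cl := \pi_Cl divisorial_one.
Definition Cl_add (a b : Cl) : Cl := \pi_Cl (divisorial_mul (repr a) (repr b)).

Lemma divisorial_mulC : commutative divisorial_mul.
Proof. by move=> I J; apply: val_inj; apply: div_mulC. Qed.

Lemma divisorial_mulA : associative divisorial_mul.
Proof. by move=> I J L; apply: val_inj; apply: div_mulA. Qed.

Lemma divisorial_mul1 : left_id divisorial_one divisorial_mul.
Proof. by move=> I; apply: val_inj; apply: div_mul1; case: (divisorialP I). Qed.

Lemma class_equiv_mull I J L :
  class_equiv I J -> class_equiv (divisorial_mul I L) (divisorial_mul J L).
Proof.
move=> /asboolP[c c0 e]; apply/asboolP; exists c => //=.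
by rewrite e div_mul_scale.
Qed.

Lemma Cl_addE I J : Cl_add (\pi_Cl I) (\pi_Cl J) = \pi_Cl (divisorial_mul I J).
Proof.
have h K : class_equiv (repr (\pi_Cl K)) K by apply/eqmodP; rewrite reprK.
apply/eqmodP; apply: (class_equiv_trans (class_equiv_mull _ (h I))).
by rewrite ![divisorial_mul I _]divisorial_mulC; apply: class_equiv_mull.
Qed.

Lemma Cl_repr (a : Cl) : a = \pi_Cl (repr a).
Proof. by rewrite reprK. Qed.

Lemma Cl_addA : associative Cl_add.
Proof.
by move=> a b c; rewrite (Cl_repr a) (Cl_repr b) (Cl_repr c) !Cl_addE divisorial_mulA.
Qed.

Lemma Cl_addC : commutative Cl_add.
Proof. by move=> a b; rewrite (Cl_repr a) (Cl_repr b) !Cl_addE divisorial_mulC. Qed.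

Lemma Cl_add0 : left_id Cl_zero Cl_add.
Proof. by move=> a; rewrite (Cl_repr a) Cl_addE divisorial_mul1. Qed.

HB.instance Definition _ := GRing.isNmodule.Build Cl Cl_addA Cl_addC Cl_add0.

End ClassGroup.

Definition transversal_polymatroid (n s : nat) (A : 'I_s -> {set 'I_n}) :
    set 'X_{1..n} :=
  [set u | exists2 i : 'I_s -> 'I_n,
     forall k, i k \in A k & (u <= \sum_(k < s) U_(i k))%MM].

(* The variables x_1, ..., x_n, t are those of {mpoly K[n.+1]}, t the last. *)
Inductive in_toric_ring (K : fieldType) (n : nat) (P : set 'X_{1..n}) :
    {mpoly K[n.+1]} -> Prop :=
| ToricConst c : in_toric_ring P c%:MP
| ToricGen v : P v -> in_toric_ring P ('X_[mnmwiden v] * 'X_ord_max)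
| ToricAdd p q : in_toric_ring P p -> in_toric_ring P q -> in_toric_ring P (p + q)
| ToricMul p q : in_toric_ring P p -> in_toric_ring P q -> in_toric_ring P (p * q).

Definition toric_pred (K : fieldType) (n : nat) (P : set 'X_{1..n}) :
  {pred {mpoly K[n.+1]}} := fun p => `[< in_toric_ring P p >].

Record toric_ring (K : fieldType) (n : nat) (P : set 'X_{1..n}) := ToricRing {
  toric_val :> {mpoly K[n.+1]};
  toric_valP : toric_val \in @toric_pred K n P }.

Section ToricRing.
Variables (K : fieldType) (n : nat) (P : set 'X_{1..n}).
Local Notation S := (toric_ring K P).

HB.instance Definition _ := [isSub for @toric_val K n P].
HB.instance Definition _ := [Choice of S by <:].

Lemma toric_subring_closed : subring_closed (@toric_pred K n P).
Proof.
split=> [|p q /asboolP hp /asboolP hq|p q /asboolP hp /asboolP hq]; apply/asboolP.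
- by rewrite -mpolyC1; apply: ToricConst.
- apply: ToricAdd => //; rewrite -mulN1r -mpolyC1 -mpolyCN.
  by apply: ToricMul => //; apply: ToricConst.
- exact: ToricMul.
Qed.

HB.instance Definition _ :=
  GRing.SubChoice_isSubComNzRing.Build _ _ S toric_subring_closed.

(* Units are classical: MathComp domains carry a total inverse function. *)
Definition toric_unit : {pred S} := fun x => `[< exists y, y * x = 1 >].

Definition toric_inv (x : S) : S :=
  if pselect (exists y, y * x = 1) is left h then projT1 (cid h) else x.

Lemma toric_mulVx : {in toric_unit, left_inverse 1 toric_inv *%R}.
Proof.
by move=> x /asboolP h; rewrite /toric_inv; case: pselect => // h'; case: cid.
Qed.

Lemma toric_unitPl (x y : S) : y * x = 1 -> toric_unit x.
Proof. by move=> e; apply/asboolP; exists y. Qed.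

Lemma toric_invr_out : {in [predC toric_unit], toric_inv =1 id}.
Proof.
move=> x; rewrite inE => /negP h; rewrite /toric_inv; case: pselect => // h'.
by case: h; apply/asboolP.
Qed.

HB.instance Definition _ := GRing.ComNzRing_hasMulInverse.Build S
  toric_mulVx toric_unitPl toric_invr_out.

Lemma toric_integral : GRing.integral_domain_axiom S.
Proof.
move=> x y /(congr1 val); rewrite rmorphM rmorph0 => /eqP.
by rewrite mulf_eq0 => /orP[] /eqP e; apply/orP; [left|right]; apply/eqP/val_inj;
   rewrite e rmorph0.
Qed.

HB.instance Definition _ := GRing.ComUnitRing_isIntegral.Build S toric_integral.

End ToricRing.

(* Z/dZ for d > 0. The library's 'Z_d would be Z/2Z for d = 1. *)
Definition cyclic_group (d : nat) : zmodType := 'I_d.-1.+1.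

Definition nmod_isomorphic (V W : nmodType) : Prop :=
  exists f : {additive V -> W}, bijective f.

(* Main.v *)
Require Import Defs.
From HB Require Import structures.
From mathcomp Require Import all_boot all_order all_algebra fraction generic_quotient.
From mathcomp Require Import boolp classical_sets mpoly.
From mathcomp Require Import zify ring lra.

(** Write D for the polynomial ring K[x_1, ..., x_n, t], R for the toric ring and
    rho(j) for the number of presenting sets that contain j.

    If the class group is cyclic of order d, then every class is killed by every
    multiple of d. Apply this to the class of the divisorial ideal generated by 1
    and 1/x_j. Its M-th power is inverse to the ideal of those f in R that x_j^M
    divides in D (membership of all f/x_j^l with l <= M), so this ideal of R is
    principal, generated by some h. Take M = d rho(j): the
    inequality u_j <= rho(j) q, valid for every monomial x^u t^q of R, says that an
    element divisible by x_j^M has t-degree at least d, and x_j^M t^d attains this.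
    If some presenting set contained i but not j, then x_j^M x_i t^d would be in R
    as well, and h would divide both. Comparing leading monomials, the cofactor of
    the second has leading t-exponent 0, hence a constant leading monomial, so that
    x_i would divide the leading monomial of h and therefore that of x_j^M t^d.
    So a presenting set that contains one element contains all of them
    ([torsion_class_mem]).

    If all s presenting sets are full, the monomials x^u t^q of R are those of
    nonnegative weight s q - |u|. The minimal weight of the terms of a polynomial is
    a valuation ([weight_minM]), and J_c, the elements of R of weight at least c, is
    the c-th symbolic power of the prime of the facet |u| = s q. One has
    (J_a J_b)'' = J_{a+b}, where '' is the double inverse ([div_mul_symbolic]), and
    J_{c+s} = t J_c ([symbolic_addt]). Every divisorial ideal is a multiple of some
    J_c ([divisorial_symbolic]): D is factorial, so the ideal has a greatest common
    divisor g in D, and up to powers of t the ideal consists of the multiples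
    of g of sufficiently large weight. Finally J_a and J_b
    with a, b < s are in one class only if a = b ([symbolic_class_inj]), because a
    divisor in R of a power of t involves t alone and has weight divisible by s.
    The class group is therefore cyclic of order s, and comparing cardinalities
    gives s = d. *)

Set Implicit Arguments.
Unset Strict Implicit.
Unset Printing Implicit Defensive.

Import Order.TTheory GRing.Theory Num.Theory.
Local Open Scope classical_set_scope.
Local Open Scope quotient_scope.
Local Open Scope ring_scope.

(** * Exponent vectors *)

Section Monomials.
Variable n : nat.
Implicit Types (u v w : 'X_{1..n}) (m : 'X_{1..n.+1}).
Local Notation widen := (widen_ord (leqnSn n)).

Lemma widen_neq_max (i : 'I_n) : (widen i == ord_max) = false.
Proof. by apply/eqP => /(congr1 val) /= e; have := ltn_ord i; rewrite e ltnn. Qed.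

Definition mnmrestrict m : 'X_{1..n} := [multinom m (widen i) | i < n].

Lemma mnmrestrictD m1 m2 : mnmrestrict (m1 + m2) = (mnmrestrict m1 + mnmrestrict m2)%MM.
Proof. by apply/mnmP => i; rewrite !(mnmE, mnmDE). Qed.

Lemma mnmrestrict_widen v : mnmrestrict (mnmwiden v) = v.
Proof. by apply/mnmP => i; rewrite mnmE mnmwiden_widen. Qed.

Lemma mnmrestrict_max k : mnmrestrict (U_(ord_max) *+ k) = 0%MM.
Proof. by apply/mnmP => i; rewrite mnmE mulmnE mnm1E mnm0E eq_sym widen_neq_max. Qed.

Lemma mnmrestrictK m : (mnmwiden (mnmrestrict m) + U_(ord_max) *+ m ord_max)%MM = m.
Proof.
apply/mnmP => i; rewrite mnmDE mulmnE mnm1E; have [<-|ni] := eqVneq ord_max i.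
  by rewrite mnmwiden_ordmax mul1n.
have lti : (i < n)%N.
  rewrite ltn_neqAle -ltnS ltn_ord andbT.
  by apply: contraNneq ni => ei; apply/eqP/val_inj.
have -> : i = widen (Ordinal lti) by apply: val_inj.
by rewrite mnmwiden_widen mnmE mul0n addn0.
Qed.

Lemma multinom_pred u : u != 0%MM -> exists i u', u = (u' + U_(i))%MM.
Proof.
move=> u0; have [i hi] : exists i, (0 < u i)%N.
  apply/existsP; apply: contraNT u0 => /existsPn h; apply/eqP/mnmP => i.
  by rewrite mnm0E; apply/eqP; rewrite -leqn0 leqNgt.
exists i, (u - U_(i))%MM; rewrite submK //; apply/mnm_lepP => j.
by rewrite mnm1E; case: eqP => [<-|].
Qed.

Lemma multinom_split k l u : (mdeg u <= k + l)%N ->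
  exists v w, [/\ u = (v + w)%MM, (mdeg v <= k)%N & (mdeg w <= l)%N].
Proof.
elim: k u => [|k ih] u hu; first by exists 0%MM, u; rewrite add0m mdeg0.
have [->|/multinom_pred[i [u' eu]]] := eqVneq u 0%MM.
  by exists 0%MM, 0%MM; rewrite add0m mdeg0.
have [|v [w [eu' hv hw]]] := ih u'; first by move: hu; rewrite eu mdegD mdeg1 addn1.
exists (v + U_(i))%MM, w; rewrite eu eu' mdegD mdeg1 addn1; split=> //.
by rewrite -addmA [(w + _)%MM]addmC addmA.
Qed.

End Monomials.

(** * Factorial domains *)

Section Factorial.
Variable D : idomainType.
Implicit Types (a b p f g y z : D) (I : set D).

Definition divides a b : Prop := exists c, b = c * a.

(** Units satisfy this predicate too, so that a factorization below needs no separate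
    unit factor. *)
Definition prime_elt p : Prop :=
  p != 0 /\ forall a b, divides p (a * b) -> divides p a \/ divides p b.

Inductive prime_product : D -> Prop :=
| PrimeProduct1 : prime_product 1
| PrimeProductM p a : prime_elt p -> prime_product a -> prime_product (p * a).

Definition factorial : Prop := forall a, a != 0 -> prime_product a.

(** A greatest common divisor that is compatible with multiplication by any y. It is the
    generator of the divisorial closure of the ideal spanned by I, and exists in a
    factorial domain for infinite I too. *)
Definition strong_gcd I g : Prop :=
  forall y z, (forall i, I i -> divides z (y * i)) <-> divides z (y * g).

Lemma dividesMl a b c : divides a b -> divides a (c * b).
Proof. by move=> [e ->]; exists (c * e); rewrite mulrA. Qed.

Lemma dividesMr a b c : divides a b -> divides a (b * c).
Proof. by rewrite mulrC; apply: dividesMl. Qed.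

Lemma dividesD a b c : divides a b -> divides a c -> divides a (b + c).
Proof. by move=> [e ->] [e' ->]; exists (e + e'); rewrite mulrDl. Qed.

Lemma dividesB a b c : divides a b -> divides a c -> divides a (b - c).
Proof. by move=> [e ->] [e' ->]; exists (e - e'); rewrite mulrBl. Qed.

Lemma unit_prime_elt u : u \is a GRing.unit -> prime_elt u.
Proof.
move=> uu; split; first by apply: contraTneq uu => ->; rewrite unitr0.
by move=> a b _; left; exists (a / u); rewrite divrK.
Qed.

Lemma prime_product_elt p : prime_elt p -> prime_product p.
Proof. by move=> h; rewrite -[p]mulr1; apply: PrimeProductM => //; apply: PrimeProduct1. Qed.

Lemma prime_product_mul a b :
  prime_product a -> prime_product b -> prime_product (a * b).
Proof.
move=> + hb; elim=> [|p c pp _ ih]; first by rewrite mul1r.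
by rewrite -mulrA; apply: PrimeProductM.
Qed.

(** Induction on the factorization of one member f of I. When f = p a, either p divides
    all of I and can be divided out, or a may be added to I without changing the
    common divisors, since p is coprime to some member of I. *)
Lemma strong_gcd_exists I f : I f -> prime_product f -> exists g, strong_gcd I g.
Proof.
move=> + hf; elim: hf I => [|p a [p0 hp] _ ih] I If.
  by exists 1 => y z; split=> [/(_ _ If)//|]; rewrite mulr1 => h i _; apply: dividesMr.
have [[i0 [Ii0 ni0]]|h] := EM (exists i, I i /\ ~ divides p i).
  have [g hg] := ih (fun i => I i \/ i = a) (or_intror erefl); exists g => y z.
  rewrite -hg; split=> [h i [/h//|->]|h i Ii]; last by apply: h; left.
  have [w ew] := h _ If; have [v ev] := h _ Ii0.
  have [z0|z0] := eqVneq z 0.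
    move/eqP: ew; rewrite z0 mulr0 mulrCA mulf_eq0 (negPf p0) /= => /eqP ya0.
    by exists 0; rewrite ya0 mul0r.
  (* From w i0 z = y i0 p a = v z p a, the prime p divides w i0. *)
  have [|[w' ew']|//] := hp w i0.
    exists (v * a); apply: (mulIf z0).
    have -> : w * i0 * z = (y * i0) * (p * a) by rewrite mulrAC -ew; ring.
    by rewrite ev; ring.
  by exists w'; apply: (mulIf p0); rewrite -mulrA [a * p]mulrC ew ew'; ring.
have hd i : I i -> divides p i.
  by move=> Ii; have [//|n] := EM (divides p i); case: h; exists i.
have [g hg] := ih (fun i => I (p * i)) If; exists (p * g) => y z.
rewrite mulrA -hg; split=> [h' i Ii|h' i Ii]; first by rewrite -mulrA; apply: h'.
have [c e] := hd _ Ii; rewrite e [c * p]mulrC mulrA; apply: h'.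
by rewrite mulrC -e.
Qed.

End Factorial.

Section Gauss.
Variable D : idomainType.
Hypothesis D_factorial : factorial D.
Implicit Types (f g h : {poly D}).

Lemma divides_polyC (p : D) f : divides p%:P f <-> forall i, divides p f`_i.
Proof.
split=> [[g ->] i|]; first by exists g`_i; rewrite coefMC.
move/choice => [c hc]; exists (\poly_(i < size f) c i); apply/polyP => i.
rewrite coefMC coef_poly; case: ltnP => // hi.
by rewrite nth_default // mul0r.
Qed.

(** If p divides f g, it divides a leading coefficient, say that of f; dropping the
    leading term of f lowers the total size. *)
Lemma prime_elt_polyC (p : D) : prime_elt p -> prime_elt p%:P.
Proof.
move=> [p0 hp]; split; first by rewrite polyC_eq0.
move=> f g; have [n] := ubnP (size f + size g); elim: n f g => // n ih f g hn.
have [->|f0] := eqVneq f 0; first by left; exists 0; rewrite mul0r.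
have [->|g0] := eqVneq g 0; first by right; exists 0; rewrite mul0r.
wlog: f g f0 g0 hn / divides p (lead_coef f) => [H hd|hl hd].
  have [] := hp (lead_coef f) (lead_coef g).
  - by rewrite -lead_coefM lead_coefE; move/divides_polyC: hd; apply.
  - by move=> h; apply: H.
  - by move=> h; apply/or_comm; apply: H => //; rewrite 1?addnC 1?mulrC.
pose f1 := take_poly (size f).-1 f.
have hff1 : divides p%:P (f - f1).
  apply/divides_polyC => i; rewrite coefB coef_take_poly; case: ltnP => hi.
    by exists 0; rewrite subrr mul0r.
  rewrite subr0; move: hi; rewrite leq_eqVlt => /orP[/eqP <- //|hi].
  by exists 0; rewrite mul0r nth_default //; move: hi; rewrite prednK ?size_poly_gt0.
have [||h|] := ih f1 g; last by right.
- rewrite -ltnS; apply: leq_trans hn; rewrite ltnS ltn_add2r.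
  by rewrite -[ltnRHS]prednK ?size_poly_gt0 // ltnS size_take_poly.
- have -> : f1 * g = f * g - g * (f - f1) by ring.
  by apply: dividesB => //; apply: dividesMl.
- by left; rewrite -(subrK f1 f); apply: dividesD.
Qed.

Lemma polyC_prime_product (a : D) : prime_product a -> prime_product a%:P.
Proof.
elim=> [|p b pp _ ih]; first exact: PrimeProduct1.
by rewrite polyCM; apply: PrimeProductM => //; apply: prime_elt_polyC.
Qed.

(** A factorization over the fraction field, written with its denominator a cleared,
    comes from a factorization of f itself: each prime factor of a divides g or h. *)
Lemma clear_scalar a f g h : prime_product a -> a != 0 -> a *: f = g * h ->
  exists g' h', [/\ f = g' * h', size g' = size g & size h' = size h].
Proof.
move=> ha; elim: ha g h => [|p b pp _ ih] g h; first by rewrite scale1r; exists g, h.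
rewrite mulf_eq0 negb_or => /andP[p0 b0] e.
have [|[k ek]|[k ek]] := (prime_elt_polyC pp).2 g h.
- by rewrite -e; exists (b *: f); rewrite -!mul_polyC polyCM; ring.
- have [|g' [h' [-> sg sh]]] := ih k h b0.
    apply: (@mulfI _ p%:P); first by rewrite polyC_eq0.
    by rewrite mul_polyC scalerA e ek; ring.
  by exists g', h'; rewrite sg sh ek [k * _]mulrC mul_polyC size_scale.
- have [|g' [h' [-> sg sh]]] := ih g k b0.
    apply: (@mulfI _ p%:P); first by rewrite polyC_eq0.
    by rewrite mul_polyC scalerA e ek; ring.
  by exists g', h'; rewrite sg sh ek [k * _]mulrC mul_polyC size_scale.
Qed.

(** The content of f is 1, in the strong form needed to cancel constants. *)
Definition primitive f := forall y z : D, divides z%:P (y%:P * f) -> divides z y.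

Lemma primitive_part f : f != 0 ->
  exists2 c : D, c != 0 & exists2 f1, f = c *: f1 & primitive f1.
Proof.
move=> f0; have lf : lead_coef f != 0 by rewrite lead_coef_eq0.
have [||c hc] := @strong_gcd_exists D (fun a => exists i, a = f`_i) (lead_coef f).
- by exists (size f).-1.
- exact: D_factorial.
have [f1 ef] : divides c%:P f.
  apply/divides_polyC => i; have /hc : divides c (1 * c) by exists 1.
  by move=> /(_ f`_i); rewrite mul1r; apply; exists i.
have c0 : c != 0 by apply: contraNneq f0 => c0; rewrite ef c0 mulr0.
exists c => //; exists f1; first by rewrite -mul_polyC mulrC.
move=> y z h; suff : divides (z * c) (y * c).
  by move=> [d]; rewrite mulrA => /(mulIf c0) ->; exists d.
apply/hc => _ [i ->]; move: i; rewrite ef => i.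
move/divides_polyC: h => /(_ i) [d]; rewrite coefCM coefMC mulrA => ->.
by exists d; rewrite mulrA.
Qed.

(** Gauss lemma for a primitive divisor: divisibility over the fraction field descends to
    the base ring, one prime factor of the denominator at a time. *)
Lemma primitive_scalar f g a : primitive f -> prime_product a -> a != 0 ->
  divides f (a *: g) -> divides f g.
Proof.
move=> prf ha; elim: ha g => [|p b pp _ ih] g; first by rewrite scale1r.
rewrite mulf_eq0 negb_or => /andP[p0 b0] [k e].
have [|[k' ek]|pf] := (prime_elt_polyC pp).2 k f.
- by rewrite -e; exists (b *: g); rewrite -!mul_polyC polyCM; ring.
- apply: ih => //; exists k'; apply: (@mulfI _ p%:P); first by rewrite polyC_eq0.
  by rewrite mul_polyC scalerA e ek; ring.
- have [u eu] : divides p 1 by apply: prf; rewrite mul1r.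
  apply: ih => //; exists (u *: k); rewrite -scalerAl -e scalerA mulrA -eu.
  by rewrite mul1r.
Qed.

Lemma irreducible_dvdpM f g h :
  irreducible_poly f -> f %| g * h -> (f %| g) || (f %| h).
Proof.
move=> irr; have [cop|] := boolP (coprimep f g); first by rewrite Gauss_dvdpr // => ->; rewrite orbT.
rewrite coprimep_def => ngc _.
by rewrite -(eqp_dvdl _ (irr.2 _ ngc (dvdp_gcdl _ _))) dvdp_gcdr.
Qed.

Lemma prime_elt_primitive f : irreducible_poly f -> primitive f -> prime_elt f.
Proof.
move=> irr prf; split=> [|g h [k e]]; first exact: irredp_neq0 irr.
have to_div q : f %| q -> divides f q.
  case/Pdiv.Idomain.dvdpP => -[c qq] /= c0 eq.
  by apply: (primitive_scalar prf (D_factorial c0)) => //; exists qq.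
have : f %| g * h by rewrite e dvdp_mull.
by move/(irreducible_dvdpM irr)/orP=> [/to_div|/to_div]; [left|right].
Qed.

(** Divide out the content, then split until the factors are irreducible over the
    fraction field; such a factor, being primitive, is prime over the base ring. *)
Lemma factorial_poly : factorial {poly D}.
Proof.
move=> f; have [n] := ubnP (size f); elim: n f => // n ih f hn f0.
have [c c0 [f1 ef prf]] := primitive_part f0.
rewrite ef -mul_polyC; apply: prime_product_mul.
  exact/polyC_prime_product/D_factorial.
have sf1 : size f1 = size f by rewrite ef size_scale.
have f10 : f1 != 0 by rewrite -size_poly_gt0 sf1 size_poly_gt0.
have [[[a g] [h [/= a0 e [sg sh]]]]|irr] := EM (exists ag : D * {poly D}, exists h,
    [/\ ag.1 != 0, ag.1 *: f1 = ag.2 * h & (size ag.2 < size f1 /\ size h < size f1)%N]).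
  have [g' [h' [e' sg' sh']]] := clear_scalar (D_factorial a0) a0 e.
  move: f10; rewrite e' mulf_eq0 negb_or => /andP[g0 h0].
  by apply: prime_product_mul; apply: ih => //;
     rewrite ?sg' ?sh' -ltnS (leq_trans _ hn) // ltnS -sf1.
have [s1|s1] := eqVneq (size f1) 1%N.
  have [b b0 ->] := size_poly1P _ (introT eqP s1).
  exact/polyC_prime_product/D_factorial.
apply/prime_product_elt/prime_elt_primitive => //; split.
  by rewrite ltn_neqAle eq_sym s1 size_poly_gt0.
move=> q sq hq; rewrite -dvdp_size_eqp // eqn_leq dvdp_leq //= leqNgt.
apply/negP => lq; apply: irr; case/Pdiv.Idomain.dvdpP: hq => -[a g] /= a0 e.
exists (a, g), q; split=> //; split=> //=.
have /andP[g0 q0] : (g != 0) && (q != 0).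
  rewrite -negb_or -mulf_eq0 -e -mul_polyC mulf_eq0 polyC_eq0.
  by rewrite (negPf a0).
have := congr1 (fun r : {poly D} => size r) e.
rewrite size_scale // size_mul // => ->.
have : (1 < size q)%N by rewrite ltn_neqAle eq_sym sq size_poly_gt0.
by case: (size q) => [|[|k]] // _; rewrite !addnS /= ltnS leq_addr.
Qed.

End Gauss.

Lemma factorial_bijective (D E : idomainType) (phi : {rmorphism D -> E}) :
  bijective phi -> factorial E -> factorial D.
Proof.
move=> [psi phiK psiK] hE.
have phi_inj := can_inj phiK.
have div_phi a b : divides (phi a) (phi b) <-> divides a b.
  split=> [[c e]|[c ->]]; last by exists (phi c); rewrite rmorphM.
  by exists (psi c); apply: phi_inj; rewrite rmorphM psiK.
have prime_phi p : prime_elt p -> prime_elt (psi p).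
  move=> [p0 hp]; split=> [|a b].
    by apply: contraNneq p0 => e; rewrite -(psiK p) e rmorph0.
  by rewrite -!div_phi psiK rmorphM; apply: hp.
have prod_psi x : prime_product x -> prime_product (psi x).
  elim=> [|p a pp _ ih].
    have -> : psi 1 = 1 by apply: phi_inj; rewrite psiK rmorph1.
    exact: PrimeProduct1.
  have -> : psi (p * a) = psi p * psi a by apply: phi_inj; rewrite rmorphM !psiK.
  by apply: PrimeProductM => //; apply: prime_phi.
move=> a a0; rewrite -(phiK a); apply/prod_psi/hE.
by apply: contraNneq a0 => e; apply/eqP/phi_inj; rewrite e rmorph0.
Qed.

Lemma muni_bijective (R : comNzRingType) (n : nat) : bijective (@muni n R).
Proof.
pose T : {mpoly R[n.+1]} := 'X_ord_max.
pose back (p : {poly {mpoly R[n]}}) := (map_poly (@mwiden n R) p).[T].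
have muniX (m : 'X_{1..n.+1}) :
    muni ('X_[m] : {mpoly R[n.+1]}) = 'X_[mnmrestrict m] *: 'X^(m ord_max).
  by rewrite muniE msuppX big_seq1 mcoeffX eqxx scale1r.
exists back => p.
  rewrite [in RHS](mpolyE p) muniE /back rmorph_sum horner_sum /=.
  apply: eq_bigr => m _.
  rewrite map_polyZ map_polyXn hornerZ hornerXn /= mwidenZ mwidenX -scalerAl.
  by rewrite /T mpolyXn -mpolyXD mnmrestrictK.
have muni_mwiden (q : {mpoly R[n]}) : muni (mwiden q) = q%:P.
  rewrite [in LHS](mpolyE q) (rmorph_sum (@mwiden n R)) (rmorph_sum (@muni n R)).
  rewrite [in RHS](mpolyE q) (rmorph_sum (@polyC _)) /=.
  apply: eq_bigr => m _; rewrite mwidenZ mwidenX muniZ muniX mnmwiden_ordmax.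
  by rewrite expr0 scalerA -mul_polyC mulr1 mul_mpolyC mnmrestrict_widen.
rewrite /back /map_poly horner_poly rmorph_sum /= -[RHS]coefK poly_def.
apply: eq_bigr => i _; rewrite rmorphM rmorphXn /= muni_mwiden.
rewrite /T muniX mnm1E eqxx expr1 mul_polyC -[U_(_)%MM]mulm1n mnmrestrict_max.
by rewrite mpolyX0 scale1r.
Qed.

Lemma factorial_mpoly (K : fieldType) (n : nat) : factorial {mpoly K[n]}.
Proof.
elim: n => [|n ih]; last first.
  exact: (factorial_bijective (muni_bijective K n) (factorial_poly ih)).
move=> p p0; apply/prime_product_elt/unit_prime_elt.
rewrite (nvar0_mpolyC p); apply: rmorph_unit; rewrite unitfE.
by apply: contraNneq p0 => e; rewrite (nvar0_mpolyC p) e.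
Qed.

(** * Weights of polynomials *)

Definition weight_ge (D : nzRingType) (n : nat) (w : 'X_{1..n} -> int) (c : int)
    (f : {mpoly D[n]}) : Prop :=
  forall m, m \in msupp f -> c <= w m.

Definition weight_min (D : nzRingType) (n : nat) (w : 'X_{1..n} -> int) (c : int)
    (f : {mpoly D[n]}) : Prop :=
  weight_ge w c f /\ exists2 m, m \in msupp f & w m = c.

Section Weight.
Variables (D : idomainType) (n : nat).
Implicit Types (f g : {mpoly D[n]}) (w : 'X_{1..n} -> int) (m : 'X_{1..n}).

Definition additive_weight w := forall m1 m2, w (m1 + m2)%MM = w m1 + w m2.

Lemma weight_ge_sub w b c f : b <= c -> weight_ge w c f -> weight_ge w b f.
Proof. by move=> h H m /H; apply: le_trans. Qed.

Lemma weight_geX w m : weight_ge w (w m) ('X_[m] : {mpoly D[n]}).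
Proof. by move=> m'; rewrite msuppX inE => /eqP->. Qed.

Lemma weight_minX w m : weight_min w (w m) ('X_[m] : {mpoly D[n]}).
Proof. by split; [apply: weight_geX | exists m; rewrite ?msuppX ?inE]. Qed.

Lemma weight_geD w c f g : weight_ge w c f -> weight_ge w c g -> weight_ge w c (f + g).
Proof. by move=> hf hg m /msuppD_le; rewrite mem_cat => /orP[/hf|/hg]. Qed.

Lemma weight_geB w c f g : weight_ge w c f -> weight_ge w c g -> weight_ge w c (f - g).
Proof. by move=> hf hg m /msuppB_le; rewrite mem_cat => /orP[/hf|/hg]. Qed.

Lemma weight_geM w a b f g : additive_weight w ->
  weight_ge w a f -> weight_ge w b g -> weight_ge w (a + b) (f * g).
Proof.
move=> wD hf hg m /msuppM_le /allpairsP[[m1 m2] /= [/hf h1 /hg h2 ->]].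
by rewrite wD lerD.
Qed.

Lemma weight_min_neq0 w c f : weight_min w c f -> f != 0.
Proof. by move=> [_ [m + _]]; apply: contraTneq => ->; rewrite msupp0. Qed.

Lemma weight_min_exists w f : f != 0 -> exists c, weight_min w c f.
Proof.
move=> f0; pose s := [seq w m | m <- msupp f].
have hs : s != [::] by rewrite -size_eq0 size_map size_eq0 msupp_eq0.
suff [c cs hc] : exists2 c, c \in s & forall d, d \in s -> c <= d.
  exists c; split; first by move=> m hm; apply/hc/map_f.
  by case/mapP: cs => m hm ->; exists m.
elim: s hs => // x [|y s] ih _.
  by exists x => [|d]; rewrite inE // => /eqP->.
have [c cs hc] := ih isT; have [lxc|lcx] := leP x c.
  exists x => [|d]; first exact: mem_head.
  by rewrite inE => /orP[/eqP-> //|/hc]; apply: le_trans.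
exists c => [|d]; first by rewrite inE cs orbT.
by rewrite inE => /orP[/eqP->|/hc //]; apply: ltW.
Qed.

Lemma weight_min_max w b c f : weight_min w c f -> weight_ge w b f -> b <= c.
Proof. by move=> [_ [m hm <-]] /(_ _ hm). Qed.

Lemma weight_min_uniq w b c f : weight_min w c f -> weight_min w b f -> b = c.
Proof.
by move=> hc hb; apply/le_anti; rewrite (weight_min_max hc hb.1) (weight_min_max hb hc.1).
Qed.

(** The part of weight c, of interest when c is the least weight in f. *)
Definition initial_form w c f := \sum_(m <- msupp f | w m == c) f@_m *: 'X_[m].

Lemma initial_formE w c f m :
  (initial_form w c f)@_m = if w m == c then f@_m else 0.
Proof.
rewrite /initial_form raddf_sum /=.
under eq_bigr do rewrite mcoeffZ mcoeffX.
have [hm|hm] := boolP (m \in msupp f); last first.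
  rewrite (memN_msupp_eq0 hm) if_same big1_seq // => k /andP[_ hk].
  by case: eqP => [e|]; rewrite ?mulr0 // -e hk in hm *.
rewrite -big_filter; case: ifP => hw.
  rewrite (bigD1_seq m) /= ?filter_uniq ?msupp_uniq ?mem_filter ?hw ?hm //.
  by rewrite eqxx mulr1 big1 ?addr0 // => k /negPf ->; rewrite mulr0.
rewrite big1_seq // => k; rewrite mem_filter => /andP[_ /andP[/eqP hk _]].
by case: eqP => [e|]; rewrite ?mulr0 // -e hk eqxx in hw *.
Qed.

Lemma weight_ge_initial w c f :
  weight_ge w c (initial_form w c f) /\ weight_ge (fun m => - w m) (- c) (initial_form w c f).
Proof.
by split=> m; rewrite mcoeff_msupp initial_formE; case: (w m =P c) => [->|]; rewrite ?eqxx.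
Qed.

Lemma weight_ge_tail w c f : weight_ge w c f -> weight_ge w (c + 1) (f - initial_form w c f).
Proof.
move=> h m; rewrite mcoeff_msupp mcoeffB initial_formE; case: (w m =P c) => [_|/eqP nc].
  by rewrite subrr eqxx.
by rewrite subr0 -mcoeff_msupp => /h hm; rewrite lezD1 lt_neqAle eq_sym nc.
Qed.

Lemma initial_form_neq0 w c f : weight_min w c f -> initial_form w c f != 0.
Proof.
move=> [_ [m hm hw]]; move: hm; rewrite mcoeff_msupp; apply: contraNneq => e.
have := initial_formE w c f m; rewrite e mcoeff0 {1}hw eqxx => f0.
by rewrite -f0.
Qed.

(** The product of the initial forms is nonzero and has terms of weight a + b only; all
    other contributions to f g have larger weight. *)
Lemma weight_minM w a b f g : additive_weight w ->
  weight_min w a f -> weight_min w b g -> weight_min w (a + b) (f * g).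
Proof.
move=> wD hf hg; have hfg := weight_geM wD hf.1 hg.1; split=> //.
have [//|no] := EM (exists2 m, m \in msupp (f * g) & w m = a + b).
set f0 := initial_form w a f; set g0 := initial_form w b g.
have fg0 : f0 * g0 != 0 by rewrite mulf_neq0 ?initial_form_neq0.
have [f0_ge f0_le] := weight_ge_initial w a f.
have [g0_ge g0_le] := weight_ge_initial w b g.
have hi : weight_ge w (a + b + 1) (f0 * g0).
  have -> : f0 * g0 = f * g - ((f - f0) * g + f0 * (g - g0)) by ring.
  apply: weight_geB.
    move=> m hm; rewrite lezD1 lt_neqAle hfg // andbT.
    by apply/eqP => e; apply: no; exists m.
  apply: weight_geD.
    by rewrite addrAC; apply: weight_geM => //; [apply: weight_ge_tail hf.1 | case: hg].
  by rewrite -addrA; apply: weight_geM => //; apply: weight_ge_tail hg.1.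
have lo : weight_ge (fun m => - w m) (- a - b) (f0 * g0).
  by apply: weight_geM => // m1 m2; rewrite wD opprD.
have [m hm] : exists m, m \in msupp (f0 * g0).
  exists (mlead (f0 * g0)); exact: mlead_supp.
by have := lo _ hm; have := hi _ hm; lia.
Qed.

(** Weights behave as valuations: a lower bound for f g and the exact weight of g give a
    lower bound for f. *)
Lemma weight_ge_cancel w a b f g : additive_weight w ->
  weight_min w b g -> weight_ge w (a + b) (f * g) -> weight_ge w a f.
Proof.
move=> wD hg hfg; have [->|/(weight_min_exists w)[c hf]] := eqVneq f 0.
  by move=> m; rewrite msupp0.
apply: weight_ge_sub hf.1; rewrite -(lerD2r b).
exact: weight_min_max (weight_minM wD hf hg) hfg.
Qed.

Lemma weight_min_exp w c f k : additive_weight w ->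
  weight_min w c f -> weight_min w (c *+ k) (f ^+ k).
Proof.
move=> wD hf; elim: k => [|k ih]; last by rewrite exprS mulrS; apply: weight_minM.
rewrite expr0 mulr0n -mpolyX0 -(_ : w 0%MM = 0); first exact: weight_minX.
by have := wD 0%MM 0%MM; rewrite addm0; lia.
Qed.

End Weight.

(** * Powers in the divisor class group *)

Section DivisorialPowers.
Variable R : idomainType.
Local Notation F := {fraction R}.
Implicit Types (A B : set F) (y z : F).

(** Divisorial products can be computed on generators. *)
Lemma div_mul_closure A B :
  div_mul (ideal_inv (ideal_inv A)) (ideal_inv (ideal_inv B)) = ideal_inv (ideal_inv (ideal_mul A B)).
Proof.
apply: ideal_inv_inj; apply/seteqP; split=> x /ideal_inv_mulP h; apply/ideal_inv_mulP => a b Aa Bb.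
  by apply: h; apply: sub_ideal_invK.
have -> : x * (a * b) = a * (x * b) by ring.
apply: Aa => a' Aa'; have -> : x * b * a' = b * (x * a') by ring.
by apply: Bb => b' Bb'; rewrite -mulrA; apply: h.
Qed.

Lemma ideal_inv_base_ring : ideal_inv (@base_ring R) = @base_ring R.
Proof.
apply/seteqP; split=> x; last by move=> Rx z; apply: base_ringM.
by move=> /(_ _ (base_ring1 R)); rewrite mulr1.
Qed.

(** Generators of the d-th power of the fractional ideal (1, y). *)
Definition powers y (d : nat) : set F := [set z | exists2 i, (i <= d)%N & z = y ^+ i].

Lemma ideal_inv_powersM y d :
  ideal_inv (ideal_mul (powers y 1) (powers y d)) = ideal_inv (powers y d.+1).
Proof.
apply/seteqP; split=> x.
  move/ideal_inv_mulP => h _ [[_ ->|i hi ->]].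
    by have := h 1 1; rewrite mulr1 expr0; apply; exists 0%N; rewrite ?expr0.
  by rewrite exprS; apply: h; [exists 1%N; rewrite ?expr1 | exists i].
move=> h; apply/ideal_inv_mulP => _ _ [i hi ->] [j hj ->].
by rewrite -exprD; apply: h; exists (i + j)%N => //; rewrite -add1n leq_add.
Qed.

Lemma fractional_ideal_inv_powers (a b : R) d : b != 0 ->
  fractional_ideal (ideal_inv (powers (tofrac a / tofrac b) d)).
Proof.
move=> b0; have b0' : tofrac b != 0 by rewrite tofrac_eq0.
split.
- exists (tofrac (b ^+ d)); last by rewrite tofrac_eq0 expf_neq0.
  move=> _ [i hi ->]; exists (b ^+ (d - i) * a ^+ i) => //.
  rewrite -{2}(subnK hi) exprD !rmorphM !rmorphXn expr_div_n -!mulrA.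
  by congr (_ * _); rewrite mulrCA divff ?mulr1 // expf_neq0.
- by move=> y z hy hz w Iw; rewrite mulrDl; apply: base_ringD; [apply: hy|apply: hz].
- by move=> r y hy w Iw; rewrite -mulrA; apply: base_ringM; [apply: base_ring_tofrac|apply: hy].
exists 1; first exact: oner_neq0.
by move=> x hx; rewrite rmorph1 mulrC; apply: hx; exists 0%N.
Qed.

(** The class x is that of the divisorial ideal generated by 1 and a/b. Its d-th power is
    the double inverse of the powers of a/b, and if this is c R then the inverse of the
    powers is R/c. The generator lies in R because 1 is among the powers. *)
Lemma torsion_power_principal (a b : R) : b != 0 ->
  exists x : Cl R, forall d, x *+ d = 0 -> exists2 h : R, h != 0 &
    ideal_inv (powers (tofrac a / tofrac b) d) = ideal_scale (tofrac h) (@base_ring R).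
Proof.
move=> b0; set y := _ / _.
have hI : divisorial_ideal (ideal_inv (ideal_inv (powers y 1))).
  split; last by rewrite ideal_inv3.
  exact/fractional_ideal_inv/fractional_ideal_inv_powers.
pose I := Divisorial (asboolT hI); exists (\pi_(Cl R) I) => d.
have [J eJ ->] : exists2 J : divisorial R, divisorial_set J = ideal_inv (ideal_inv (powers y d))
    & (\pi_(Cl R) I) *+ d = \pi_(Cl R) J.
  elim: d => [|d [J eJ e]].
    exists (divisorial_one R) => //=.
    have -> : ideal_inv (powers y 0) = base_ring (R := R); last first.
      by rewrite ideal_inv_base_ring.
    apply/seteqP; split=> x; first by move=> h; rewrite -[x]mulr1; apply: h; exists 0%N.
    by move=> hx _ [i + ->]; rewrite leqn0 => /eqP->; rewrite expr0 mulr1.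
  exists (divisorial_mul I J); last by rewrite mulrS e; apply: Cl_addE.
  by rewrite /= eJ div_mul_closure; apply: ideal_inv_inj; apply: ideal_inv_powersM.
move/eqmodP => /asboolP[c c0]; rewrite /= eJ => /(congr1 (@ideal_inv R)).
rewrite ideal_inv3 ideal_inv_scale // => e.
rewrite ideal_inv_base_ring in e.
have [h _ eh] : base_ring c^-1.
  have : ideal_inv (powers y d) c^-1.
    by rewrite e; exists 1; rewrite ?mulr1 //; apply: base_ring1.
  by move=> /(_ 1); rewrite mulr1; apply; exists 0%N.
by exists h; rewrite ?eh // -tofrac_eq0 eh invr_eq0.
Qed.

End DivisorialPowers.

Lemma nmod_isomorphic_cyclic_torsion (V : nmodType) (d : nat) (x : V) k :
  (0 < d)%N -> nmod_isomorphic V (cyclic_group d) -> x *+ (d * k) = 0.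
Proof.
case: d => // d _ [f /bij_inj f_inj]; apply: f_inj; rewrite raddf0 mulrnA raddfMn /=.
rewrite raddfMn; have -> : f x *+ d.+1 = 0; last by rewrite mul0rn.
by rewrite [LHS]Zp_mulrn; apply: val_inj; rewrite /= modnMl.
Qed.

(** * Membership in a toric ring *)

Section ToricMembership.
Variables (K : fieldType) (n : nat) (P : set 'X_{1..n}).
Local Notation D := {mpoly K[n.+1]}.
Local Notation S := (toric_ring K P).

Definition toric_elt (f : D) (h : in_toric_ring P f) : S := ToricRing (asboolT h).

Lemma toric_valM (r r' : S) : toric_val (r * r') = toric_val r * toric_val r'.
Proof. by []. Qed.

Lemma toric_valX (r : S) k : toric_val (r ^+ k) = toric_val r ^+ k.
Proof.
by elim: k => [|k ih]; rewrite ?expr0 // !exprS toric_valM ih.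
Qed.

Lemma toric_val_inj : injective (@toric_val K n P).
Proof. exact: val_inj. Qed.

Lemma toric_val_eq0 (r : S) : (toric_val r == 0) = (r == 0).
Proof. by apply/eqP/eqP => [e|-> //]; apply: toric_val_inj. Qed.

Lemma toric_eltP (r : S) : in_toric_ring P (toric_val r).
Proof. by case: r => f h; apply/asboolP. Qed.

Lemma in_toric_ring1 : in_toric_ring P (1 : D).
Proof. by rewrite -mpolyC1; apply: ToricConst. Qed.

(** A linear inequality that holds on the generators holds on all monomials of the ring. *)
Lemma in_toric_ring_weight (w : 'X_{1..n.+1} -> int) (f : D) : additive_weight w ->
  (forall v, P v -> 0 <= w (mnmwiden v + U_(ord_max))%MM) ->
  in_toric_ring P f -> weight_ge w 0 f.
Proof.
move=> wD hw; elim=> [c|v Pv|g h _ hg _ hh|g h _ hg _ hh].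
- move=> m; rewrite msuppC; case: ifP => // _; rewrite inE => /eqP->.
  by have := wD 0%MM 0%MM; rewrite addm0; lia.
- by rewrite -mpolyXD => m; rewrite msuppX inE => /eqP->; apply: hw.
- exact: weight_geD.
- by rewrite -[0]addr0; apply: weight_geM.
Qed.
End ToricMembership.

(** * A torsion class forces the presenting sets to be full *)

Section TorsionClass.
Variables (K : fieldType) (n s : nat) (A : 'I_s -> {set 'I_n}).
Local Notation P := (transversal_polymatroid A).
Local Notation D := {mpoly K[n.+1]}.
Local Notation S := (toric_ring K P).
Local Notation widen := (widen_ord (leqnSn n)).
Local Notation x j := ('X_(widen j) : D).
Local Notation t := ('X_ord_max : D).

(** The rank of the singleton j. *)
Definition rho (j : 'I_n) : nat := #|[set k | j \in A k]%SET|.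

Hypothesis A_nonempty : forall k, A k != finset.set0.

Lemma polymatroid_rho v j : P v -> (v j <= rho j)%N.
Proof.
move=> [i hi /mnm_lepP /(_ j)] hv; apply: leq_trans hv _.
rewrite mnm_sumE /rho -sum1_card big_mkcond /=.
rewrite [leqRHS]big_mkcond /=; apply: leq_sum => k _.
rewrite mnm1E inE; case: eqP => [<-|_] //; by rewrite hi.
Qed.

Lemma toric_rho f m j : in_toric_ring P (f : D) -> m \in msupp f ->
  (m (widen j) <= rho j * m ord_max)%N.
Proof.
move=> hf hm; pose w m : int := (rho j * m ord_max)%N%:Z - (m (widen j))%:Z.
suff : weight_ge w 0 f by move=> /(_ _ hm); rewrite /w; lia.
apply: in_toric_ring_weight hf => [m1 m2|v /polymatroid_rho hv]; rewrite /w !mnmDE; first lia.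
rewrite mnmwiden_ordmax mnmwiden_widen !mnm1E eqxx.
rewrite [ord_max == _]eq_sym widen_neq_max.
have := hv j; lia.
Qed.

(** Choose j from each of the rho j sets that contain j; the set k0 is not among them and
    still supplies i. *)
Lemma polymatroid_mem i j k0 b c : i \in A k0 -> j \notin A k0 ->
  (b <= rho j)%N -> (c <= 1)%N -> P (U_(j) *+ b + U_(i) *+ c)%MM.
Proof.
move=> ik jk hb hc.
(* The last alternative only has to pick some element of A k. *)
pose g k := if j \in A k then j else if i \in A k then i else odflt j [pick l in A k].
exists g => [k|].
  rewrite /g; case: ifP => // _; case: ifP => // _; case: pickP => //= h.
  by have /finset.set0Pn[l] := A_nonempty k; have := h l => /= ->.
apply/mnm_lepP => l; rewrite mnmDE !mulmnE !mnm1E mnm_sumE.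
have nij : j != i by apply: contraTneq ik => <-.
have [<-|jl] := eqVneq j l.
  rewrite eq_sym (negPf nij) mul0n addn0 mul1n; apply: leq_trans hb _.
  rewrite /rho -sum1_card big_mkcond /=; apply: leq_sum => k _.
  by rewrite mnm1E inE /g; case: (j \in A k); rewrite ?eqxx.
rewrite mul0n add0n; case: eqP => [<-|_]; last by [].
rewrite mul1n; apply: leq_trans hc _; rewrite (bigD1 k0) //= mnm1E /g.
by rewrite (negPf jk) ik eqxx.
Qed.

Lemma toric_monomial i j k0 b c N : i \in A k0 -> j \notin A k0 -> (0 < N)%N ->
  (b <= N * rho j)%N -> (c <= 1)%N -> in_toric_ring P (x j ^+ b * x i ^+ c * t ^+ N).
Proof.
move=> ik jk; case: N => // N _.
have gen b' c' : (b' <= rho j)%N -> (c' <= 1)%N -> in_toric_ring P (x j ^+ b' * x i ^+ c' * t).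
  move=> hb hc; have := ToricGen K (polymatroid_mem ik jk hb hc).
  rewrite -mwidenX mpolyXD -!mpolyXn rmorphM !rmorphXn /= !mwidenX !mnmwiden1.
  by [].
elim: N b c => [|N ih] b c hb hc.
  by rewrite expr1; apply: gen => //; rewrite -[rho j]mul1n.
have -> : x j ^+ b * x i ^+ c * t ^+ N.+2 =
    (x j ^+ (minn b (rho j)) * x i ^+ 0 * t) * (x j ^+ (b - minn b (rho j)) * x i ^+ c * t ^+ N.+1).
  rewrite -{1}(subnKC (geq_minl b (rho j))) exprD exprS expr0; ring.
apply: ToricMul; first by apply: gen; rewrite ?geq_minr.
apply: ih => //; move: hb; rewrite mulSn; lia.
Qed.

(** Stated over the field K itself, so that the leading monomials of the factors and of
    the product are terms over one and the same coefficient structure. *)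
Lemma mlead_mul (f g : D) : f != 0 -> g != 0 -> mlead (f * g) = (mlead f + mlead g)%MM.
Proof. exact: mleadM. Qed.

(** With y = 1/x_j and M = d rho(j), the element h generates the ideal of those f in R
    that x_j^M divides. That ideal contains x_j^M t^d, and also x_j^M x_i t^d if k0
    contains i but not j; the leading monomials of their cofactors contradict each other. *)
Lemma torsion_class_mem d i j k0 : (0 < d)%N -> (0 < rho j)%N ->
  nmod_isomorphic (Cl S) (cyclic_group d) -> i \in A k0 -> j \in A k0.
Proof.
move=> d0 r0 iso ik; apply/negPn/negP => jk.
have hmon := toric_monomial ik jk.
have hX : in_toric_ring P (x j * t).
  by have := hmon 1 0 1%N isT; rewrite expr1 expr0 mulr1 expr1; apply; rewrite ?mul1n.
have hT : in_toric_ring P t.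
  by have := hmon 0 0 1%N isT; rewrite !expr0 !mul1r expr1; apply.
pose X := toric_elt hX; pose T := toric_elt hT.
have t0 : t != 0 by rewrite -msupp_eq0 msuppX.
have X0 : X != 0.
  by rewrite -toric_val_eq0 /= mulf_neq0 // -msupp_eq0 msuppX.
have [c hc] := torsion_power_principal T X0.
set y := tofrac T / tofrac X in hc.
pose M := (d * rho j)%N.
have [h h0 eh] := hc M (nmod_isomorphic_cyclic_torsion c (rho j) d0 iso).
(* The fraction y is 1/x_j. *)
have in_inv (r : S) : (forall l, (l <= M)%N ->
    exists2 f, in_toric_ring P f & toric_val r = x j ^+ l * f) ->
    ideal_inv (powers y M) (tofrac r).
  move=> hr _ [l /hr[f hf ef] ->]; exists (toric_elt hf) => //.
  have : r * T ^+ l = toric_elt hf * X ^+ l.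
    by apply: toric_val_inj; rewrite !toric_valM !toric_valX ef /= exprMn; ring.
  move/(congr1 (@tofrac S)); rewrite !rmorphM !rmorphXn /= => e.
  have X0' : tofrac X ^+ l != 0 by rewrite expf_neq0 // tofrac_eq0.
  by apply: (mulIf X0'); rewrite -e expr_div_n -mulrA divfK.
have mult e (he : in_toric_ring P (x j ^+ M * x i ^+ e * t ^+ d)) : (e <= 1)%N ->
    exists r : S, x j ^+ M * x i ^+ e * t ^+ d = toric_val h * toric_val r.
  move=> e1; have : ideal_inv (powers y M) (tofrac (toric_elt he)).
    apply: in_inv => l hl; exists (x j ^+ (M - l) * x i ^+ e * t ^+ d).
      by apply: hmon => //; apply: leq_trans (leq_subr _ _) _.
    by rewrite /= -{1}(subnKC hl) exprD; ring.
  rewrite eh => -[_ [r _ <-]]; rewrite -rmorphM => /eqP; rewrite tofrac_eq => /eqP /(congr1 (@toric_val _ _ _)).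
  by rewrite toric_valM /= => <-; exists r.
have [r er] := mult 0%N (hmon M 0%N d d0 (leqnn _) isT) isT.
have [r2 er2] := mult 1%N (hmon M 1%N d d0 (leqnn _) isT) isT.
have [r' er'] : exists r' : S, toric_val h * t ^+ M = toric_val r' * (x j * t) ^+ M.
  have : ideal_inv (powers y M) (tofrac h).
    by rewrite eh; exists 1; rewrite ?mulr1 //; apply: base_ring1.
  move=> /(_ (y ^+ M)) [|r' _ e]; first by exists M.
  exists r'; have : h * T ^+ M = r' * X ^+ M.
    apply/eqP; rewrite -tofrac_eq !rmorphM !rmorphXn /= e expr_div_n.
    by rewrite -!mulrA mulVf ?mulr1 // expf_neq0 // tofrac_eq0.
  by move=> /(congr1 (@toric_val _ _ _)); rewrite !toric_valM !toric_valX.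
have h0' : toric_val h != 0 by rewrite toric_val_eq0.
have nz (f g : D) m : f * g = 'X_[m] -> [/\ f != 0, g != 0 & (mlead f + mlead g = m)%MM].
  move=> e; have : f * g != 0 by rewrite e -msupp_eq0 msuppX.
  by rewrite mulf_eq0 negb_or => /andP[f0 g0]; rewrite -mlead_mul // e mleadXm.
have ex e : x j ^+ M * x i ^+ e * t ^+ d = 'X_[U_(widen j) *+ M + U_(widen i) *+ e + U_(ord_max) *+ d].
  by rewrite !mpolyXD !mpolyXn.
have [_ r0' m1] := nz _ _ _ (etrans (esym er) (ex 0%N)).
have [_ r20 m2] := nz _ _ _ (etrans (esym er2) (ex 1%N)).
have hL : (M <= mlead (toric_val h) (widen j))%N.
  have r'0 : toric_val r' != 0.
    have : toric_val h * t ^+ M != 0 by rewrite mulf_neq0 // expf_neq0.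
    by rewrite er' mulf_eq0 negb_or => /andP[].
  have := congr1 (fun f => mlead f (widen j)) er'.
  rewrite exprMn !mpolyXn -mpolyXD !mlead_mul ?mleadXm //; try by rewrite -msupp_eq0 msuppX.
  by rewrite !mnmDE !mulmnE !mnm1E eqxx mul1n; clear; lia.
have hr := toric_rho j (toric_eltP h) (mlead_supp h0').
have hr2 := toric_rho i (toric_eltP r2) (mlead_supp r20).
have nij : j != i by apply: contraTneq ik => <-.
have wij : widen j == widen i = false.
  by apply: contraNF nij => /eqP/(congr1 val) /= e; apply/eqP/val_inj.
have := congr1 (fun m : 'X_{1..n.+1} => m ord_max) m2.
have := congr1 (fun m : 'X_{1..n.+1} => m (widen i)) m2.
have := congr1 (fun m : 'X_{1..n.+1} => m (widen i)) m1.
rewrite !mnmDE !mulmnE !mnm1E !eqxx wij ![ord_max == widen _]eq_sym !widen_neq_max.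
rewrite  ?(mul0n, mul1n, muln0, muln1, addn0, add0n) => a1 a2 a3.
have : (d <= mlead (toric_val h) ord_max)%N.
  by rewrite -(leq_pmul2l r0) mulnC (leq_trans _ hr).
move=> hd; have z : mlead (toric_val r2) ord_max = 0%N by clear -a3 hd; lia.
by rewrite z muln0 in hr2; clear -hr2 a1 a2; lia.
Qed.

End TorsionClass.

(** * The class group when all presenting sets are full *)

Lemma fraction_repr (R : idomainType) (y : {fraction R}) :
  exists p q : R, q != 0 /\ y = tofrac p / tofrac q.
Proof.
elim/quotW: y => r; exists r.1, r.2; split; first exact: denom_ratioP.
rewrite /GRing.inv /= /GRing.mul /= !piE; apply/eqmodP.
rewrite /= FracField.equivfE /FracField.invf /FracField.mulf.
rewrite !numden_Ratio ?oner_neq0 ?mulf_neq0 ?oner_neq0 ?denom_ratioP //.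
by rewrite mulr1 mul1r mulrC.
Qed.

Lemma transversal_full n s (A : 'I_s -> {set 'I_n}) (v : 'X_{1..n}) : (0 < n)%N ->
  (forall k, A k = finset.setT) -> transversal_polymatroid A v <-> (mdeg v <= s)%N.
Proof.
move=> n0 hA; split.
  move=> [i _ hv]; have -> : s = mdeg (\sum_(k < s) U_(i k))%MM.
    by rewrite mdeg_sum; under eq_bigr do rewrite mdeg1; rewrite sum1_card card_ord.
  by rewrite -(submK hv) mdegD leq_addl.
move=> hv; suff [i hi] : exists i : nat -> 'I_n, (v <= \sum_(k < s) U_(i k))%MM.
  by exists (fun k : 'I_s => i k) => // k; rewrite hA finset.in_setT.
elim: s v hv {A hA} => [|s ih] v.
  rewrite leqn0 mdeg_eq0 => /eqP->; exists (fun=> Ordinal n0).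
  by apply/mnm_lepP => j; rewrite mnm0E.
have [-> _|/multinom_pred[i [v' ->]]] := eqVneq v 0%MM.
  by exists (fun=> Ordinal n0); apply/mnm_lepP => j; rewrite mnm0E.
rewrite mdegD mdeg1 addn1 ltnS => /ih[g hg].
exists (fun k => if k == s then i else g k).
rewrite big_ord_recr /= eqxx (eq_bigr (fun k : 'I_s => U_(g k)%MM)) => [|k _].
  by apply/mnm_lepP => j; rewrite !mnmDE leq_add2r; move/mnm_lepP: hg.
by rewrite ltn_eqF.
Qed.

Section FullCase.
Variables (K : fieldType) (n s : nat) (P : set 'X_{1..n}).
Hypotheses (n_gt0 : (0 < n)%N) (s_gt0 : (0 < s)%N).
Hypothesis PE : forall v, P v <-> (mdeg v <= s)%N.
Local Notation D := {mpoly K[n.+1]}.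
Local Notation S := (toric_ring K P).
Local Notation F := {fraction S}.
Local Notation widen := (widen_ord (leqnSn n)).
Local Notation t := ('X_ord_max : D).

(** The height of the exponent vector (u, q) above the facet |u| = s q of the cone of R. *)
Definition face_weight (m : 'X_{1..n.+1}) : int :=
  (s * m ord_max)%N%:Z - (mdeg (mnmrestrict m))%:Z.

Local Notation wt := face_weight.

Lemma face_weightD : additive_weight wt.
Proof. by move=> m1 m2; rewrite /wt mnmrestrictD mdegD mnmDE; lia. Qed.
Local Hint Resolve face_weightD : core.

Lemma face_weight_t k : wt (U_(ord_max) *+ k) = (s * k)%N%:Z.
Proof. by rewrite /wt mnmrestrict_max mdeg0 mulmnE mnm1E eqxx mul1n subr0. Qed.

(** The monomials of nonnegative weight are products of q generators: u splits into
    q exponent vectors of degree at most s. *)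
Lemma in_toric_ringE (f : D) : in_toric_ring P f <-> weight_ge wt 0 f.
Proof.
split.
  apply: in_toric_ring_weight => // v /PE hv; rewrite face_weightD.
  rewrite -[U_(_)%MM]mulm1n face_weight_t /wt mnmrestrict_widen mnmwiden_ordmax; lia.
move=> hf; have mon u q : (mdeg u <= s * q)%N -> in_toric_ring P ('X_[mnmwiden u] * t ^+ q).
  elim: q u => [|q ih] u.
    rewrite muln0 leqn0 mdeg_eq0 => /eqP->; rewrite mnmwiden0 mpolyX0 mul1r.
    exact: in_toric_ring1.
  rewrite mulnS => /multinom_split[v [w [-> /PE Pv /ih hw]]].
  rewrite mnmwidenD mpolyXD exprS mulrACA; apply: ToricMul => //.
  exact: ToricGen.
rewrite (mpolyE f) big_seq; elim/big_ind: _ => [|g h|m hm].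
- rewrite -mpolyC0; exact: ToricConst.
- exact: ToricAdd.
- rewrite -mul_mpolyC; apply: ToricMul; first exact: ToricConst.
  rewrite -(mnmrestrictK m) mpolyXD -mpolyXn; apply: mon.
  have := hf _ hm; rewrite /wt; lia.
Qed.

Lemma weight_toric (r : S) : weight_ge wt 0 (toric_val r).
Proof. exact/in_toric_ringE/toric_eltP. Qed.

Lemma weight_min_t k : weight_min wt (s * k)%N%:Z (t ^+ k).
Proof. by rewrite mpolyXn -face_weight_t; apply: weight_minX. Qed.

Lemma in_toric_ring_t : in_toric_ring P t.
Proof.
by apply/in_toric_ringE; apply: weight_ge_sub (weight_min_t 1).1; rewrite muln1.
Qed.

Definition toric_t : S := toric_elt in_toric_ring_t.

Lemma toric_t_val k : toric_val (toric_t ^+ k) = t ^+ k.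
Proof. by rewrite toric_valX. Qed.

Lemma toric_t_neq0 k : toric_t ^+ k != 0.
Proof. by rewrite -toric_val_eq0 toric_t_val; apply: weight_min_neq0 (weight_min_t k). Qed.

Local Notation x0 := ('X_(widen (Ordinal n_gt0)) : D).

Lemma weight_min_uniformizer : weight_min wt 1 (x0 ^+ s.-1 * t).
Proof.
rewrite mpolyXn -mpolyXD.
have <- : wt (U_(widen (Ordinal n_gt0)) *+ s.-1 + U_(ord_max)) = 1; last exact: weight_minX.
rewrite face_weightD -[U_(ord_max)%MM]mulm1n face_weight_t /wt.
have -> : mnmrestrict (U_(widen (Ordinal n_gt0)) *+ s.-1) = (U_(Ordinal n_gt0) *+ s.-1)%MM.
  by apply/mnmP => i; rewrite mnmE !mulmnE !mnm1E.
rewrite mdegMn mdeg1 mulmnE mnm1E.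
rewrite widen_neq_max; lia.
Qed.

Lemma in_toric_ring_uniformizer : in_toric_ring P (x0 ^+ s.-1 * t).
Proof. by apply/in_toric_ringE; apply: weight_ge_sub weight_min_uniformizer.1. Qed.

(** An element of weight exactly 1; its c-th power attains the weight bound that defines
    J_c. *)
Definition uniformizer : S := toric_elt in_toric_ring_uniformizer.

Lemma weight_min_uniformizerX k : weight_min wt k%:Z (toric_val (uniformizer ^+ k)).
Proof.
rewrite toric_valX -[k%:Z]natz; exact: weight_min_exp weight_min_uniformizer.
Qed.

Lemma uniformizer_neq0 k : uniformizer ^+ k != 0.
Proof. by rewrite -toric_val_eq0; apply: weight_min_neq0 (weight_min_uniformizerX k). Qed.

(** Large weight forces a large t-exponent, since the x-part can only lower the weight. *)
Lemma weight_div_t (c k : nat) (f : D) : weight_ge wt (c + s * k)%N%:Z f ->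
  exists2 g : S, f = toric_val (toric_t ^+ k * g) & weight_ge wt c%:Z (toric_val g).
Proof.
move=> hf.
(* The weight s q - |u| is at least s k, hence q >= k. *)
have hk m : m \in msupp f -> (U_(ord_max) *+ k <= m)%MM.
  move=> /hf hm; apply/mnm_lepP => i; rewrite mulmnE mnm1E; case: eqP => [<-|//].
  rewrite mul1n -(leq_pmul2l s_gt0); move: hm; rewrite /wt; lia.
pose g := \sum_(m <- msupp f) f@_m *: 'X_[m - U_(ord_max) *+ k] : D.
have eg : f = g * 'X_[U_(ord_max) *+ k].
  rewrite /g mulr_suml [LHS]mpolyE; apply: eq_big_seq => m /hk hm.
  by rewrite -scalerAl -mpolyXD submK.
have wg : weight_ge wt c%:Z g.
  move=> m hm; have : (U_(ord_max) *+ k + m)%MM \in msupp f.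
    by rewrite eg (perm_mem (msuppMX _ _)) map_f.
  by move/hf; rewrite face_weightD face_weight_t; lia.
have tg : in_toric_ring P g by apply/in_toric_ringE; apply: weight_ge_sub wg.
by exists (toric_elt tg) => //; rewrite toric_valM toric_t_val /= mulrC mpolyXn.
Qed.

(** The c-th symbolic power of the height one prime of the facet |u| = s q, as a set of
    fractions. *)
Definition symbolic (c : nat) : set F :=
  [set tofrac r | r in [set r : S | weight_ge wt c%:Z (toric_val r)]].

Lemma symbolic_t (c k : nat) : (c <= s * k)%N -> symbolic c (tofrac (toric_t ^+ k)).
Proof.
move=> h; exists (toric_t ^+ k) => //=; rewrite toric_t_val.
by apply: weight_ge_sub (weight_min_t k).1.
Qed.

Lemma symbolic_uniformizer (c : nat) : symbolic c (tofrac (uniformizer ^+ c)).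
Proof. by exists (uniformizer ^+ c) => //=; case: (weight_min_uniformizerX c). Qed.

Lemma symbolicM a b x y : symbolic a x -> symbolic b y -> symbolic (a + b) (x * y).
Proof.
move=> [r hr <-] [r' hr' <-]; exists (r * r'); last exact: tofracM.
suff : weight_ge wt (a + b)%N%:Z (toric_val (r * r')) by [].
by rewrite toric_valM PoszD; apply: weight_geM.
Qed.

Lemma symbolicD c x y : symbolic c x -> symbolic c y -> symbolic c (x + y).
Proof.
move=> [r hr <-] [r' hr' <-]; exists (r + r'); last exact: rmorphD.
exact: weight_geD.
Qed.

Lemma symbolic0 : symbolic 0 = @base_ring S.
Proof.
apply/seteqP; split=> _ [r hr <-]; first exact: base_ring_tofrac.
by exists r => //; apply: weight_toric.
Qed.

Lemma symbolicZ c (r : S) x : symbolic c x -> symbolic c (tofrac r * x).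
Proof.
move=> hx; rewrite -[c]add0n; apply: symbolicM => //.
by rewrite symbolic0; apply: base_ring_tofrac.
Qed.

Lemma symbolic_sub c x : symbolic c x -> base_ring x.
Proof. by move=> [r _ <-]; apply: base_ring_tofrac. Qed.

Lemma symbolic_addt (c k : nat) :
  symbolic (c + s * k) = ideal_scale (tofrac (toric_t ^+ k)) (symbolic c).
Proof.
apply/seteqP; split=> [_ [r hr <-]|_ [x hx <-]].
  have [g eg wg] := weight_div_t hr; exists (tofrac g); first by exists g.
  by rewrite -tofracM; congr (tofrac _); apply: toric_val_inj.
by rewrite mulrC; apply: symbolicM => //; apply: symbolic_t.
Qed.

(** A power of t and an element of weight exactly c already determine the inverse: if y
    carries both into R, then y has t-power denominator and weight at least -c. *)
Lemma ideal_inv_symbolic (c N : nat) (G : set F) : G `<=` symbolic c ->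
  G (tofrac (toric_t ^+ N)) -> G (tofrac (uniformizer ^+ c)) ->
  ideal_inv G = ideal_inv (symbolic c).
Proof.
move=> sG Gt Gu; apply/seteqP; split; last exact: ideal_inv_sub.
move=> y hy _ [j hj <-].
have [f _ ef] := hy _ Gt; have [g _ eg] := hy _ Gu.
have efg : f * uniformizer ^+ c = g * toric_t ^+ N.
  by apply/eqP; rewrite -tofrac_eq !tofracM /= ef eg; apply/eqP; ring.
have wf : weight_ge wt ((s * N)%N%:Z - c%:Z) (toric_val f).
  apply: (weight_ge_cancel face_weightD (weight_min_uniformizerX c)).
  rewrite -toric_valM efg toric_valM toric_t_val subrK -[X in weight_ge _ X]add0r.
  by apply: weight_geM => //; [apply: weight_toric | case: (weight_min_t N)].
have wfj : weight_ge wt (0 + s * N)%N%:Z (toric_val (f * j)).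
  by rewrite add0n -(subrK c%:Z (s * N)%N%:Z) toric_valM; apply: weight_geM.
have [g' eg' _] := weight_div_t wfj.
exists g' => //; have tn : tofrac (toric_t ^+ N) != 0 by rewrite tofrac_eq0 toric_t_neq0.
apply: (mulfI tn); rewrite -tofracM -(toric_val_inj eg') tofracM ef; ring.
Qed.

(** The fraction v^(c(s-1)) / t^c, where v has weight 1, carries J_c into R and has
    weight -c, so that the double inverse has no element of weight below c. *)
Lemma symbolic_divisorial c : divisorial_ideal (symbolic c).
Proof.
split; first split.
- exists (tofrac (uniformizer ^+ c)); first exact: symbolic_uniformizer.
  by rewrite tofrac_eq0 uniformizer_neq0.
- exact: symbolicD.
- by move=> r x; apply: symbolicZ.
- exists 1; first exact: oner_neq0.
  by move=> x /symbolic_sub hx; rewrite rmorph1 mul1r.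
apply/seteqP; split; last exact: sub_ideal_invK.
move=> x hx.
have [f _ ef] : base_ring x.
  by rewrite -[x]mulr1; apply: hx => y /symbolic_sub; rewrite mul1r.
have tn : tofrac (toric_t ^+ c) != 0 by rewrite tofrac_eq0 toric_t_neq0.
have [r _ er] : base_ring (x * (tofrac (uniformizer ^+ (c * s.-1)) / tofrac (toric_t ^+ c))).
  apply: hx => _ [j hj <-].
  have wj : weight_ge wt (0 + s * c)%N%:Z (toric_val (uniformizer ^+ (c * s.-1) * j)).
    have -> : (0 + s * c)%N%:Z = (c * s.-1)%N%:Z + c%:Z by rewrite -PoszD; congr Posz; nia.
    by rewrite toric_valM; apply: weight_geM => //; case: (weight_min_uniformizerX (c * s.-1)).
  have [g eg _] := weight_div_t wj; exists g => //.
  apply: (mulfI tn); rewrite -tofracM -(toric_val_inj eg) tofracM.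
  by rewrite mulrA [tofrac (toric_t ^+ c) * _]mulrC divfK.
exists f => //=; rewrite -[c%:Z](addrK (c * s.-1)%N%:Z).
apply: (weight_ge_cancel face_weightD (weight_min_uniformizerX (c * s.-1))).
have -> : c%:Z + (c * s.-1)%N%:Z - (c * s.-1)%N%:Z + (c * s.-1)%N%:Z = (s * c)%N%:Z.
  by rewrite addrK -PoszD; congr Posz; nia.
rewrite -toric_valM; have -> : f * uniformizer ^+ (c * s.-1) = r * toric_t ^+ c.
  by apply/eqP; rewrite -tofrac_eq !tofracM /= ef er -mulrA divfK.
rewrite toric_valM toric_t_val -[X in weight_ge _ X]add0r.
by apply: weight_geM => //; [apply: weight_toric | case: (weight_min_t c)].
Qed.

Definition symbolic_class (c : nat) : Cl S :=
  \pi_(Cl S) (Divisorial (asboolT (symbolic_divisorial c))).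

Lemma div_mul_symbolic a b : div_mul (symbolic a) (symbolic b) = symbolic (a + b).
Proof.
have [_ <-] := symbolic_divisorial (a + b); apply: ideal_inv_inj.
have pair x y : symbolic a x -> symbolic b y -> ideal_mul (symbolic a) (symbolic b) (x * y).
  move=> hx hy; exists [:: (x, y)]; last by rewrite big_seq1.
  by move=> p; rewrite inE => /eqP->.
apply: (@ideal_inv_symbolic (a + b) (a + b)).
- move=> _ [l hl ->]; rewrite big_seq; elim/big_ind: _ => [||p /hl[h1 h2]].
  + exists 0; last exact: rmorph0.
    by move=> m; rewrite (_ : toric_val 0 = 0) // msupp0.
  + exact: symbolicD.
  + exact: symbolicM.
- by rewrite exprD tofracM; apply: pair; apply: symbolic_t; apply: leq_pmull.
- by rewrite exprD tofracM; apply: pair; apply: symbolic_uniformizer.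
Qed.

Lemma symbolic_class0 : symbolic_class 0 = 0.
Proof. by congr (\pi_(Cl S) _); apply: val_inj; apply: symbolic0. Qed.

Lemma symbolic_classD a b : symbolic_class a + symbolic_class b = symbolic_class (a + b).
Proof.
rewrite [LHS]Cl_addE; congr (\pi_(Cl S) _); apply: val_inj => /=.
exact: div_mul_symbolic.
Qed.

Lemma symbolic_class_mod c : symbolic_class c = symbolic_class (c %% s).
Proof.
apply/eqmodP/asboolP; exists (tofrac (toric_t ^+ (c %/ s))).
  by rewrite tofrac_eq0 toric_t_neq0.
by rewrite /= -symbolic_addt {1}(divn_eq c s) addnC mulnC.
Qed.

(** Minus the x-degree is also a weight. It is at most 0 on both q and r and 0 on their
    product, so q involves t alone. *)
Lemma divisor_t_face_weight (q r : S) k c : q * r = toric_t ^+ k ->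
  weight_min wt c (toric_val q) -> (exists l : nat, c = (s * l)%N%:Z).
Proof.
move=> e [_ [m hm <-]]; exists (m ord_max).
pose w (m : 'X_{1..n.+1}) : int := - (mdeg (mnmrestrict m))%:Z.
have wD : additive_weight w by move=> m1 m2; rewrite /w mnmrestrictD mdegD; lia.
have [q0 r0] : toric_val q != 0 /\ toric_val r != 0.
  by have := toric_t_neq0 k; rewrite -e mulf_eq0 negb_or !toric_val_eq0 => /andP[].
have [a ha] := weight_min_exists w q0; have [b hb] := weight_min_exists w r0.
have h0 : weight_min w 0 (toric_val (q * r)).
  have <- : w (U_(ord_max) *+ k)%MM = 0 by rewrite /w mnmrestrict_max mdeg0.
  by rewrite e toric_t_val mpolyXn; apply: weight_minX.
have ab := weight_min_uniq h0 (weight_minM wD ha hb).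
have b_le0 : b <= 0 by case: hb => _ [m' _ <-]; rewrite /w; lia.
have := ha.1 _ hm; rewrite /w /wt; lia.
Qed.

(** If J_a = c J_b, then c has weight a - b and c t is in R. Symmetrically t/c is in R,
    so c t divides t^2 and its weight s + a - b is a multiple of s. *)
Lemma symbolic_class_inj a b : (a < s)%N -> (b < s)%N ->
  symbolic_class a = symbolic_class b -> a = b.
Proof.
move=> ha hb /eqmodP/asboolP[c c0] /= eab.
have ofa x : symbolic a x -> symbolic b (c^-1 * x).
  by rewrite eab => -[y hy <-]; rewrite mulKf.
have ofb x : symbolic b x -> symbolic a (c * x) by rewrite eab => hx; exists x.
have t1 d : (d < s)%N -> symbolic d (tofrac (toric_t ^+ 1)).
  by move=> hd; apply: symbolic_t; rewrite muln1 ltnW.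
have [j _ ej] := ofa _ (t1 _ ha).
have [j2 wj2 ej2] := ofb _ (t1 _ hb).
have [j3 wj3 ej3] := ofa _ (symbolic_uniformizer a).
have [j4 wj4 ej4] := ofb _ (symbolic_uniformizer b).
have tinj (p q : S) : tofrac p = tofrac q -> p = q by move/eqP; rewrite tofrac_eq => /eqP.
have e1 : j2 * j = toric_t ^+ 2.
  by apply: tinj; rewrite tofracM ej ej2 mulrACA mulfV // mul1r -tofracM -exprD.
have e2 : j2 * j3 = toric_t ^+ 1 * uniformizer ^+ a.
  by apply: tinj; rewrite !tofracM ej2 ej3 mulrACA mulfV // mul1r.
have e3 : j2 * uniformizer ^+ b = j4 * toric_t ^+ 1.
  by apply: tinj; rewrite !tofracM ej2 ej4 mulrAC.
have j20 : toric_val j2 != 0.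
  by have := toric_t_neq0 2; rewrite -e1 mulf_eq0 negb_or toric_val_eq0 => /andP[].
have [v hv] := weight_min_exists wt j20.
have [l el] := divisor_t_face_weight e1 hv.
have v_le : v <= (s + a)%N%:Z - b%:Z.
  rewrite lerBrDr; have := weight_geM face_weightD hv.1 wj3.
  rewrite -toric_valM e2 toric_valM; apply: weight_min_max.
  rewrite PoszD; apply: weight_minM => //; last exact: weight_min_uniformizerX.
  by have := weight_min_t 1; rewrite muln1 toric_t_val.
have v_ge : (s + a)%N%:Z - b%:Z <= v.
  rewrite lerBlDr.
  apply: (weight_min_max (weight_minM face_weightD hv (weight_min_uniformizerX b))).
  rewrite -toric_valM e3 toric_valM addnC PoszD; apply: weight_geM => //.
  by have := (weight_min_t 1).1; rewrite muln1 toric_t_val.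
have hsl : (s + a = s * l + b)%N by lia.
have [l0|l2|l1] := ltngtP l 1%N; last by move: hsl; rewrite l1 muln1 => /addnI.
  by move: l0; rewrite ltnS leqn0 => /eqP l0; rewrite l0 in hsl; lia.
by have : (s * 2 <= s * l)%N; [rewrite leq_pmul2l | lia].
Qed.

(** Scale I into R and take its strong gcd g in D. If m is the least weight in the scaled
    ideal, then its elements are the multiples of g of weight at least m. One inclusion
    is clear. For the other, y in the inverse of I carries g into D and has weight at
    least -m, so it carries any such multiple to an element of nonnegative weight. *)
Lemma divisorial_symbolic (I : set F) : divisorial_ideal I ->
  exists c, exists2 y, y != 0 & I = ideal_scale y (symbolic c).
Proof.
move=> [[[x1 Ix1 x10] _ _ [e e0 he]] Idiv].
have e0' : tofrac e != 0 by rewrite tofrac_eq0.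
pose I0 (f : S) := I (tofrac f / tofrac e).
have I0P x : I x -> exists2 f, I0 f & x = tofrac f / tofrac e.
  move=> Ix; have [f _ ef] := he _ Ix.
  have ex : x = tofrac f / tofrac e by rewrite ef mulrC mulKf.
  by exists f; rewrite // /I0 -ex.
have [f1 If1 f10] : exists2 f, I0 f & f != 0.
  have [f If ex1] := I0P _ Ix1; exists f => //.
  by apply: contraNneq x10 => f0; rewrite ex1 f0 tofrac0 mul0r.
have f10' : toric_val f1 != 0 by rewrite toric_val_eq0.
have [g hg] := @strong_gcd_exists D (fun h => exists2 f, I0 f & h = toric_val f)
  (toric_val f1) (ex_intro2 _ _ f1 If1 erefl) (@factorial_mpoly K n.+1 _ f10').
have g_dvd f : I0 f -> exists h, toric_val f = h * g.
  move=> If; have /hg : divides g (1 * g) by exists 1.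
  by move=> /(_ (toric_val f)); rewrite mul1r; apply; exists f.
have g0 : g != 0.
  by have [h eh] := g_dvd _ If1; apply: contraNneq f10' => g0; rewrite eh g0 mulr0.
have [a ha] := weight_min_exists wt g0.
have [m [f0 If0 wf0] m_min] : exists2 m : nat,
    (exists2 f, I0 f & weight_min wt m%:Z (toric_val f)) &
    forall f, I0 f -> weight_ge wt m%:Z (toric_val f).
  have hex : exists m : nat, `[< exists2 f, I0 f & weight_min wt m%:Z (toric_val f) >].
    have [c hc] := weight_min_exists wt f10'.
    have c0 : 0 <= c := weight_min_max hc (@weight_toric f1).
    by exists `|c|%N; apply/asboolP; exists f1; rewrite // gez0_abs.
  have [m /asboolP hm m_min] := ex_minnP hex; exists m => // f If.
  have [f_0|f_n0] := eqVneq (toric_val f) 0; first by rewrite f_0 => k; rewrite msupp0.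
  have [c hc] := weight_min_exists wt f_n0.
  have c0 : 0 <= c := weight_min_max hc (@weight_toric f).
  apply: weight_ge_sub hc.1; rewrite -(gez0_abs c0) lez_nat; apply: m_min.
  by apply/asboolP; exists f; rewrite // gez0_abs.
(* Powers of t make g an element of R and the exponent c below a natural number. *)
have [l la] : exists l : nat, `|a| <= (s * l)%N%:Z by exists (absz (a : int)); nia.
have gt_in : in_toric_ring P (t ^+ l * g).
  apply/in_toric_ringE; apply: (@weight_ge_sub _ _ _ 0 ((s * l)%N%:Z + a)); first lia.
  by apply: weight_geM => //; [case: (weight_min_t l) | case: ha].
have [g' eg'] : exists g' : S, toric_val g' = t ^+ l * g by exists (toric_elt gt_in).
have [c ec] : exists c : nat, c%:Z = m%:Z - a + (s * l)%N%:Z.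
  by exists (absz (m%:Z - a + (s * l)%N%:Z : int)); lia.
have g'0 : g' != 0 by rewrite -toric_val_eq0 eg' mulf_neq0 // expf_neq0 // -msupp_eq0 msuppX.
have g'0' : tofrac g' != 0 by rewrite tofrac_eq0.
have [T eT] : exists T, T = toric_t ^+ (l + l) by exists (toric_t ^+ (l + l)).
have T0 : tofrac T != 0 by rewrite eT tofrac_eq0 toric_t_neq0.
exists c, (tofrac g' / tofrac T / tofrac e).
  exact: (mulf_neq0 (mulf_neq0 g'0' (invr_neq0 T0)) (invr_neq0 e0')).
apply/seteqP; split=> [x /I0P[f If ->]|_ [_ [j wj <-] <-]].
  have [h eh] := g_dvd _ If.
  have wh : weight_ge wt c%:Z (h * t ^+ l).
    rewrite ec; apply: weight_geM => //; last by case: (weight_min_t l).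
    by apply: (weight_ge_cancel face_weightD ha); rewrite subrK -eh; apply: m_min.
  have hj : in_toric_ring P (h * t ^+ l) by apply/in_toric_ringE; apply: weight_ge_sub wh.
  exists (tofrac (toric_elt hj)); first by exists (toric_elt hj).
  have -> : tofrac f = tofrac g' * tofrac (toric_elt hj) / tofrac T.
    apply: (mulIf T0); rewrite divfK // -!tofracM; congr (tofrac _); apply: toric_val_inj.
    by rewrite !toric_valM eT eg' toric_t_val eh exprD /=; ring.
  by rewrite mulrAC; congr (_ / _); rewrite mulrAC.
rewrite -Idiv => y hy.
have [p [q [q0 ey]]] := fraction_repr y.
have q0' : tofrac q != 0 by rewrite tofrac_eq0.
have key f : I0 f -> exists r, p * f = r * (q * e).
  move=> If; have [r _ er] := hy _ If; exists r; apply/eqP; rewrite -tofrac_eq.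
  rewrite !tofracM er ey; apply/eqP.
  have fld (L : fieldType) (u v b d : L) : b != 0 -> d != 0 ->
      u * v = u / b * (v / d) * (b * d) by move=> b0 d0; field; rewrite b0 d0.
  exact (fld _ _ _ _ _ q0' e0').
have [w ew] : divides (toric_val (q * e)) (toric_val p * g).
  apply/hg => _ [f If ->]; have [r er] := key _ If.
  by exists (toric_val r); rewrite -!toric_valM er.
have [r0 er0] := key _ If0.
have qe0 : toric_val (q * e) != 0 by rewrite toric_val_eq0; apply: (mulf_neq0 q0 e0).
have erw : toric_val r0 * g = w * toric_val f0.
  apply: (mulIf qe0); have := congr1 (@toric_val _ _ _) er0; rewrite !toric_valM => er0'.
  transitivity (toric_val r0 * (toric_val q * toric_val e) * g); first by ring.
  rewrite -er0' mulrAC ew toric_valM; ring.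
have ww : weight_ge wt (a - m%:Z) w.
  apply: (weight_ge_cancel face_weightD wf0); rewrite subrK -erw -[a]add0r.
  by apply: weight_geM => //; [apply: weight_toric | case: ha].
have wj' : weight_ge wt (0 + s * (l + l))%N%:Z (t ^+ l * w * toric_val j).
  have -> : (0 + s * (l + l))%N%:Z = (s * l)%N%:Z + (a - m%:Z) + c%:Z.
    by rewrite ec add0n mulnDr PoszD; ring.
  by do 2?apply: weight_geM => //; case: (weight_min_t l).
have [z ez _] := weight_div_t wj'.
have ez' : g' * j * p = z * (T * (q * e)).
  apply: toric_val_inj; rewrite !toric_valM eg'.
  transitivity (t ^+ l * toric_val j * (toric_val p * g)); first by ring.
  rewrite ew toric_valM.
  transitivity (t ^+ l * w * toric_val j * (toric_val q * toric_val e)); first by ring.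
  by rewrite ez toric_valM -eT; ring.
exists z => //.
have den0 : tofrac (T * (q * e)) != 0.
  by rewrite !tofracM; exact: (mulf_neq0 T0 (mulf_neq0 q0' e0')).
apply: (mulIf den0); rewrite -tofracM -ez' !tofracM ey.
have fld (L : fieldType) (u v w' b d k : L) : b != 0 -> d != 0 -> k != 0 ->
    u * v * w' = u / b / d * v * (w' / k) * (b * (k * d)).
  by move=> b0 d0 k0; field; rewrite b0 d0 k0.
exact (fld _ _ _ _ _ _ _ T0 e0' q0').
Qed.

Lemma symbolic_class_surj (x : Cl S) : exists c, x = symbolic_class c.
Proof.
have [c [y y0 e]] := divisorial_symbolic (divisorialP (repr x)).
by exists c; rewrite (Cl_repr x); apply/eqmodP/asboolP; exists y.
Qed.

Lemma Cl_cyclic : nmod_isomorphic (Cl S) (cyclic_group s).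
Proof.
pose phi (i : cyclic_group s) : Cl S := symbolic_class (i : 'I_s.-1.+1).
have phiD i j : phi (i + j) = phi i + phi j.
  rewrite /phi symbolic_classD [RHS]symbolic_class_mod /=.
  by congr (symbolic_class (_ %% _)); rewrite prednK.
have phi_inj : injective phi.
  have lt_s (i : cyclic_group s) : ((i : 'I_s.-1.+1) < s)%N by rewrite -[ltnRHS]prednK.
  by move=> i j /(symbolic_class_inj (lt_s i) (lt_s j)) /val_inj.
have phi_surj x : exists i, phi i = x.
  have [c ->] := symbolic_class_surj x.
  have hc : (c %% s < s.-1.+1)%N by rewrite prednK // ltn_pmod.
  by exists (Ordinal hc : 'I_s.-1.+1); rewrite symbolic_class_mod.
have [f fK] : exists f, cancel f phi.
  by have [f hf] := choice phi_surj; exists f.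
have f_morph : nmod_morphism f.
  split; last by move=> x y; apply: phi_inj; rewrite phiD !fK.
  by apply: phi_inj; rewrite fK -symbolic_class0.
pose g : {additive Cl S -> cyclic_group s} :=
  HB.pack f (GRing.isNmodMorphism.Build _ _ f f_morph).
exists g.
by exists phi => //= i; apply: phi_inj; rewrite fK.
Qed.

End FullCase.

(** * The classification *)

Theorem theorem4p9 (K : fieldType) (n s : nat) (A : 'I_s -> {set 'I_n})
    (hn : (0 < n)%N)
    (hA : forall k : 'I_s, A k != finset.set0)
    (hcover : (\bigcup_(k < s) A k)%SET = finset.setT)
    (d : nat) (hd : (0 < d)%N) :
  nmod_isomorphic (Cl (toric_ring K (transversal_polymatroid A))) (cyclic_group d)
  <-> (forall k : 'I_s, A k = finset.setT) /\ s = d.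
Proof.
have cover j : exists k, j \in A k.
  have : j \in (\bigcup_(k < s) A k)%SET by rewrite hcover finset.in_setT.
  by case/bigcupP => k _ jk; exists k.
have s0 : (0 < s)%N.
  by have [k _] := cover (Ordinal hn); apply: leq_ltn_trans (ltn_ord k).
have full_cyclic : (forall k, A k = finset.setT) ->
    nmod_isomorphic (Cl (toric_ring K (transversal_polymatroid A))) (cyclic_group s).
  by move=> hT; apply: Cl_cyclic => // v; apply: transversal_full.
split=> [iso|[hT <-]]; last exact: full_cyclic.
have hT k : A k = finset.setT.
  apply/setP => j; rewrite finset.in_setT.
  have /finset.set0Pn[i ik] := hA k.
  apply: (torsion_class_mem hA hd _ iso ik).
  by have [k' jk'] := cover j; apply/card_gt0P; exists k'; rewrite inE.
split=> //; have [f [f' fK f'K]] := iso.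
have [g [g' gK g'K]] := full_cyclic hT.
have : bijective (fun i : 'I_s.-1.+1 => f (g' i) : 'I_d.-1.+1).
  by exists (fun i => g (f' i)) => i; rewrite /= ?fK ?g'K ?gK ?f'K.
by move/bij_eq_card; rewrite !card_ord !prednK.
Qed.
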